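(* Let $J$ be a coanalytic ideal on $\omega$ that has a topological representation. Then $J$ is either $\mathbf{\Pi}^0_3$-complete or $\mathbf{\Pi}^1_1$-complete. Moreover, $J$ is $\mathbf{\Pi}^0_3$-complete if and only if $J$ is represented by a $\mathbf{\Pi}^0_2$ ideal of compact sets.
   Context: An ideal on a set $E$ is a family of subsets of $E$ closed under taking subsets and finite unions; it is always assumed to contain all singletons $\{s\}$, $s\in E$. Subsets of $\omega$ are identified with elements of $2^\omega$ via characteristic functions, and the descriptive complexity of an ideal on $\omega$ is its complexity as a subset of the Cantor space $2^\omega$. A $\sigma$-ideal on a set $X$ is a family of subsets of $X$ closed under taking subsets and countable unions, assumed to contain all singletons of $X$. Given a separable metrizable space $X$, a $\sigma$-ideal $I$ on $X$ and a countable dense set $D\subseteq X$, let $J_I=\{a\subseteq D:\mathrm{cl}(a)\in I\}$, where $\mathrm{cl}$ is closure in $X$; this depends only on the family of closed sets that belong to $I$. An ideal $J$ on a countable set $E$ has a topological representation if there are such $X$, $I$, $D$ and a bijection $\rho:E\to D$ with $J=\{a\subseteq E:\rho(a)\in J_I\}$, where $\rho(a)$ is the image of $a$; in this case $J$ is said to be represented by $I$. For a compact metrizable space $X$, $K(X)$ is the space of compact subsets of $X$ with the Vietoris topology. A $\sigma$-ideal of compact sets on $X$ is a family $I\subseteq K(X)$ containing all singletons, closed under taking compact subsets, and such that any compact set which is a countable union of members of $I$ belongs to $I$. $J$ is represented by a $\mathbf{\Pi}^0_2$ ideal of compact sets if there are a compact metrizable space $X$, a $\sigma$-ideal $I\subseteq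 K(X)$ of compact sets which is a $\mathbf{\Pi}^0_2$ subset of $K(X)$, a countable dense $D\subseteq X$ and a bijection $\rho:\omega\to D$ such that $J=\{a\subseteq\omega:\mathrm{cl}(\rho(a))\in I\}$.
   Formalization: The ideal J is additionally assumed to be proper (ω is not in J); for J = P(ω), which is represented by the ideal K(X), the claim fails because J is all of the Cantor space and so complete for neither class. *)

(* Defs.v *)
From HB Require Import structures.
From mathcomp Require Import all_boot all_order all_algebra.
From mathcomp Require Import all_classical all_reals all_analysis.
From mathcomp Require Import borel_hierarchy.

Set Implicit Arguments.
Unset Strict Implicit.
Unset Printing Implicit Defensive.

Import Order.TTheory GRing.Theory Num.Theory.

Local Open Scope classical_set_scope.
Local Open Scope ring_scope.

(* Metrizable spaces are quantified over as spaces [X : metricType R]; every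
   notion below depends only on the topology of [X] (for Polish spaces: on the
   existence of a complete compatible metric). *)

Definition separable (T : topologicalType) :=
  exists2 D : set T, countable D & dense D.

(* [exists l, F --> l] rather than the library's [cvg F], since the latter is
   restricted to pointed spaces. *)
Definition polish (R : realType) (Y : metricType R) :=
  separable Y /\
  forall F : set_system Y, ProperFilter F -> cauchy F -> exists l : Y, F --> l.

(* The library's [zero_dimensional] only asks that clopen sets separate points,
   which is weaker for Polish spaces (complete Erdos space). *)
Definition clopen_basis (T : topologicalType) :=
  exists2 B : set (set T), B `<=` clopen & basis B.

Definition pointclass := forall T : topologicalType, set (set T).

(* Boldface Pi^0_2 is the library's [Gdelta], boldface Sigma^0_2 is [Fsigma]. *)
Definition Pi03 : pointclass := fun T S =>
  exists2 F : (set T)^nat, (forall i, Fsigma (F i)) & S = \bigcap_i F i.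

Definition baire_space : Type := prod_topology (fun _ : nat => nat).

HB.instance Definition _ := Topological.on baire_space.

Definition analytic : pointclass := fun T S =>
  S = set0 \/ exists2 f : baire_space -> T, continuous f & S = range f.

Definition coanalytic : pointclass := fun T S => analytic (~` S).

(* Hardness and completeness for continuous (Wadge) reductions from arbitrary
   zero-dimensional Polish spaces. *)
Definition hard (R : realType) (Gamma : pointclass) (T : topologicalType)
    (A : set T) :=
  forall Y : metricType R, polish Y -> clopen_basis Y ->
  forall B : set Y, Gamma Y B ->
  exists2 f : Y -> T, continuous f & B = f @^-1` A.

Definition complete_for (R : realType) (Gamma : pointclass)
    (T : topologicalType) (A : set T) :=
  Gamma T A /\ hard R Gamma A.

Definition char_set (J : set (set nat)) : set cantor_space :=
  [set x | J [set n | x n]].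

Definition ideal (E : Type) (J : set (set E)) :=
  [/\ forall a b, a `<=` b -> J b -> J a,
      forall a b, J a -> J b -> J (a `|` b)
    & forall s, J [set s]].

Definition sigma_ideal (X : Type) (I : set (set X)) :=
  [/\ forall a b, a `<=` b -> I b -> I a,
      forall F : (set X)^nat, (forall n, I (F n)) -> I (\bigcup_n F n)
    & forall x, I [set x]].

Definition closure_ideal (X : topologicalType) (I : set (set X)) (D : set X) :
  set (set X) := [set a | a `<=` D /\ I (closure a)].

Definition topologically_represented (R : realType) (J : set (set nat)) :=
  exists (X : metricType R) (I : set (set X)) (D : set X) (rho : nat -> X),
    [/\ separable X, sigma_ideal I, countable D, dense D
      & set_bij [set: nat] D rho /\
        J = [set a | closure_ideal I D (rho @` a)]].

Definition hyperspace (X : topologicalType) := {K : set X | compact K}.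

HB.instance Definition _ (X : topologicalType) := gen_eqMixin (hyperspace X).
HB.instance Definition _ (X : topologicalType) :=
  gen_choiceMixin (hyperspace X).

Definition vietoris_subbase (X : topologicalType) : set (set (hyperspace X)) :=
  [set A | exists2 U : set X, open U &
    A = [set K | sval K `<=` U] \/ A = [set K | sval K `&` U !=set0]].

HB.instance Definition _ (X : topologicalType) :=
  isSubBaseTopological.Build (hyperspace X) (@vietoris_subbase X) id.

Definition compact_sigma_ideal (X : topologicalType)
    (I : set (hyperspace X)) :=
  [/\ forall K L : hyperspace X, sval K `<=` sval L -> I L -> I K,
      forall (F : nat -> hyperspace X) (K : hyperspace X),
        (forall n, I (F n)) -> sval K = \bigcup_n sval (F n) -> I K
    & forall (x : X) (K : hyperspace X), sval K = [set x] -> I K].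

Definition represented_by_Pi02_compact (R : realType) (J : set (set nat)) :=
  exists (X : metricType R) (I : set (hyperspace X)) (D : set X)
      (rho : nat -> X),
    [/\ compact [set: X], compact_sigma_ideal I /\ Gdelta I,
        countable D, dense D
      & set_bij [set: nat] D rho /\
        J = [set a | (sval @` I) (closure (rho @` a))]].

(* Main.v *)
(* Write "a ~> K" when every limit point of the set of indices [a] lies in [K].

   A representation of [J] yields a code [e] of the natural numbers by points
   of the Cantor space such that [J] is tall and, for [a] in [J] and [b] not in
   [J], some basic clopen set misses [a] and meets [b] outside [J].  Conversely,
   by a Baire category argument, [J] is represented on the closure [X] of the
   range of [e] by the sigma-ideal [small] of those compact [K] for which
   "b ~> K" implies [b] in [J].

   The complement of [small] is analytic, and Hurewicz' derivative argument
   applies to it: either it is Sigma^0_2, or there are compact sets K_s in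
   [small], indexed by finite sequences, such that K_(s,k) tends to K_s from
   above while along each branch the sets K_s keep enough of a fixed set of
   indices outside [J].  Putting together finite sets of indices close to the
   K_s, [s] in a tree [T], gives an element of [J] exactly when [T] is
   well-founded, so that [J] is Pi^1_1-hard.

   [J] is always Pi^0_3-hard: around a point all of whose neighbourhoods have
   indices forming a set outside [J] one finds non-small compact sets
   converging to that point, and the [i]th of them is filled up exactly when
   the [i]th column of a 0-1 matrix is infinite.  The same reduction of Pi^0_3 sets to matrices is of Lipschitz
   type, hence its composition with a putative Pi^0_3 definition of the matrices
   with an infinite column has a fixed point, which is contradictory; so no
   Pi^1_1-hard set is Pi^0_3. *)
From HB Require Import structures.
Require Import Defs.
From mathcomp Require Import all_boot all_order all_algebra.
From mathcomp Require Import all_classical all_reals all_analysis.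
From mathcomp Require Import borel_hierarchy.
From mathcomp Require Import zify.
From mathcomp Require finmap.

Set Implicit Arguments.
Unset Strict Implicit.
Unset Printing Implicit Defensive.

Import Order.TTheory GRing.Theory Num.Theory.

Local Open Scope classical_set_scope.

(** * Agreement of sequences on prefixes, limits and branches *)

Section Sequences.
Context {T : Type}.
Implicit Types x y z : nat -> T.

Definition agree (n : nat) x y := forall i, i < n -> x i = y i.

Lemma agree_refl n x : agree n x x. Proof. by []. Qed.

Lemma agree_sym n x y : agree n x y -> agree n y x.
Proof. by move=> xy i /xy. Qed.

Lemma agree_trans n y x z : agree n x y -> agree n y z -> agree n x z.
Proof. by move=> xy yz i ni; rewrite xy// yz. Qed.

Lemma agree_le n m x y : n <= m -> agree m x y -> agree n x y.
Proof. by move=> nm xy i ni; apply: xy; apply: leq_trans nm. Qed.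

Lemma agree_mkseq n x y : mkseq x n = mkseq y n <-> agree n x y.
Proof.
split=> [xy i ni|xy]; last first.
  by apply/eq_in_map => i; rewrite mem_iota => /andP[_]; apply: xy.
by have := congr1 (fun s => nth (x 0) s i) xy; rewrite !nth_mkseq.
Qed.

Lemma agree_limit (x : nat -> nat -> T) (l : nat -> nat) :
  (forall n, n <= l n) -> (forall n, l n <= l n.+1) ->
  (forall n, agree (l n) (x n) (x n.+1)) ->
  exists y, forall n, agree (l n) (x n) y.
Proof.
(* Digit [i] is final from stage [i.+1] on, since [l i.+1] exceeds [i]. *)
move=> nl lS xS; exists (fun i => x i.+1 i) => n i iln.
have lle a b : l a <= l (a + b).
  by elim: b => [|b ih]; rewrite ?addn0// addnS (leq_trans ih).
have aux a b : agree (l a) (x a) (x (a + b)).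
  elim: b => [|b ih]; rewrite ?addn0// addnS.
  exact: agree_trans ih (agree_le (lle _ _) (xS _)).
case: (leqP n i.+1) => ni.
  by rewrite -(subnKC ni); apply: aux.
rewrite -(subnKC (ltnW ni)); apply/esym/aux.
exact: leq_trans (nl _).
Qed.

(** Closedness in the product of discrete copies of [T], stated through prefixes. *)
Definition limit_closed (K : set (nat -> T)) :=
  forall x, (forall n, exists2 y, K y & agree n x y) -> K x.

End Sequences.

Lemma dependent_choice_seq (A : Type) (R : nat -> A -> A -> Prop) (a0 : A) :
  (forall n a, exists b, R n a b) ->
  exists f : nat -> A, f 0 = a0 /\ forall n, R n (f n) (f n.+1).
Proof.
move=> Rex; have [g Hg] := choice (fun p : nat * A => Rex p.1 p.2).
pose f := nat_rect (fun _ => A) a0 (fun n a => g (n, a)).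
by exists f; split=> // n; apply: (Hg (n, f n)).
Qed.

Lemma konig (Q : seq bool -> Prop) : Q [::] ->
  (forall s, Q s -> exists b, Q (rcons s b)) ->
  exists x : nat -> bool, forall n, Q (mkseq x n).
Proof.
move=> Q0 QS.
have [|g Hg] := @choice _ _ (fun s b => Q s -> Q (rcons s b)).
  move=> s.
  have [/QS[b Qb]|nQ] := pselect (Q s); first by exists b.
  by exists true => /nQ.
pose p := nat_rect (fun _ => seq bool) [::] (fun _ s => rcons s (g s)).
exists (fun n => g (p n)) => n.
suff -> : mkseq (fun n => g (p n)) n = p n by elim: n => //= n /Hg.
by elim: n => //= n ih; rewrite mkseqS ih.
Qed.

(** * Tall and countably separated ideals *)

Definition tall (J : set (set nat)) := forall b, infinite_set b ->
  exists a, [/\ a `<=` b, infinite_set a & J a].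

(** The array [e] is read in two ways: for fixed [n] it gives a set of indices, and these countably
    many sets separate; for fixed [k] it gives a point [e k] of the Cantor space. *)
Definition separating (J : set (set nat)) (e : nat -> nat -> bool) :=
  forall a b, J a -> ~ J b -> exists n,
    (forall k, a k -> e k n = false) /\ ~ J (b `&` [set k | e k n]).

(** * Ideals separated by a countable family of sets *)

Section CountablySeparatedIdeals.
Variables (J : set (set nat)) (e : nat -> nat -> bool).
Hypothesis idealJ : ideal J.
Hypothesis tallJ : tall J.
Hypothesis sepJ : separating J e.

Implicit Types (a b c : set nat) (K L : set (nat -> bool)).

Lemma J_sub a b : a `<=` b -> J b -> J a. Proof. by case: idealJ => + _ _; apply. Qed.

Lemma J_setU a b : J a -> J b -> J (a `|` b).
Proof. by case: idealJ => _ + _; apply. Qed.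

Lemma J_bounded a N : (forall d, a d -> d < N) -> J a.
Proof.
move=> aN; apply: (@J_sub _ [set d | d < N]); first by move=> d /aN.
elim: N {aN} => [|N ih].
  by apply: (@J_sub _ [set 0]) => //; case: idealJ.
apply: (@J_sub _ ([set d | d < N] `|` [set N])); last first.
  by apply: J_setU => //; case: idealJ.
by move=> d /=; rewrite ltnS leq_eqVlt => /orP[/eqP ->|]; [right|left].
Qed.

Lemma notJ_unbounded b N : ~ J b -> exists2 d, b d & N <= d.
Proof.
move=> nJ; apply: contrapT => h; apply/nJ/(@J_bounded _ N) => d bd.
by rewrite ltnNge; apply/negP => Nd; apply: h; exists d.
Qed.

Lemma infinite_unbounded b N : infinite_set b -> exists2 d, b d & N <= d.
Proof.
move=> infb; apply: contrapT => h; apply: infb.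
apply: (@sub_finite_set _ _ `I_N); last exact: finite_II.
by move=> d bd /=; rewrite ltnNge; apply/negP => Nd; apply: h; exists d.
Qed.

Lemma notJ_sub a b : a `<=` b -> ~ J a -> ~ J b.
Proof. by move=> ab nJ /(J_sub ab). Qed.

Lemma notJ_tail b N : ~ J b -> ~ J (b `&` [set d | N <= d]).
Proof.
move=> nJ Jb; apply: nJ.
apply: (@J_sub _ ((b `&` [set d | N <= d]) `|` [set d | d < N])).
  by move=> d bd /=; case: (leqP N d) => ?; [left|right].
by apply: J_setU => //; apply: (@J_bounded _ N).
Qed.

Definition cell b n (x : nat -> bool) := b `&` [set d | agree n (e d) x].

(** The analogue of the set of limit points of [e] along [b], with [J] in place of the ideal of
    finite sets. *)
Definition positive_part b := [set x | forall n, ~ J (cell b n x)].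

Definition converges b K :=
  forall n, exists N, forall d, b d -> N <= d -> exists2 x, K x & agree n (e d) x.

Definition small K := forall b, converges b K -> J b.

Lemma small_sub K L : K `<=` L -> small L -> small K.
Proof.
move=> KL sL b bK; apply: sL => n; have [N h] := bK n; exists N => d bd Nd.
by have [x Kx dx] := h _ bd Nd; exists x => //; apply: KL.
Qed.

Lemma positive_part_sub a b : a `<=` b -> positive_part a `<=` positive_part b.
Proof. by move=> ab x ax n; apply: notJ_sub (ax n) => d [/ab]. Qed.

Lemma positive_part_setU a b :
  positive_part (a `|` b) `<=` positive_part a `|` positive_part b.
Proof.
move=> x abx; apply: contrapT => /not_orP[/existsNP[n /contrapT an]].
move=> /existsNP[m /contrapT bm]; apply: (abx (maxn n m)).
apply: J_sub (J_setU an bm) => d [[] bd xd]; [left|right]; split=> //;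
  by apply: agree_le xd; rewrite ?leq_maxl ?leq_maxr.
Qed.

Lemma positive_part_closed b : limit_closed (positive_part b).
Proof.
move=> x h n; have [y by_ xy] := h n; apply: notJ_sub (by_ n) => d [bd dy].
by split=> //; apply: agree_trans dy (agree_sym xy).
Qed.

Lemma positive_part_unbounded b x n N : positive_part b x ->
  exists d, [/\ b d, N <= d & agree n (e d) x].
Proof. by move=> /(_ n)/(notJ_unbounded N)[d [bd dx] Nd]; exists d. Qed.

(** When a set outside [J] is split by the next digit, one half is outside [J]; following such
    halves gives a point. *)
Lemma positive_part_nonempty b : ~ J b -> positive_part b !=set0.
Proof.
move=> nJ; pose Q s := ~ J (b `&` [set d | mkseq (e d) (size s) = s]).
have [|s Qs|x Qx] := @konig Q.
- by apply: notJ_sub nJ => d bd; split.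
- apply: contrapT => /forallNP h; apply: Qs.
  have Jr i : J (b `&` [set d | mkseq (e d) (size (rcons s i)) = rcons s i]).
    by apply: contrapT; apply: (h i).
  apply: J_sub (J_setU (Jr true) (Jr false)) => d [bd /= ds].
  rewrite !size_rcons !mkseqS ds.
  by case: (e d (size s)); [left|right].
- exists x => n; apply: notJ_sub (Qx n) => d [bd /=].
  by rewrite size_mkseq => /agree_mkseq.
Qed.

Lemma positive_part_cell b n x :
  positive_part (cell b n x) `<=` positive_part b `&` [set y | agree n y x].
Proof.
move=> y h; split=> /=; first by apply: positive_part_sub h => d [].
have [d [[_ dx] _ dy]] := positive_part_unbounded n 0 h.
exact: agree_trans (agree_sym dy) dx.
Qed.

(** There are finitely many cylinders of level [n], so representatives in [b] can be bounded. The
    induction splits [b] by digit [n]. *)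
Lemma finite_cells n b : exists N, forall d, b d ->
  exists2 d', b d' & d' < N /\ agree n (e d) (e d').
Proof.
elim: n b => [|n ih] b.
  have [[d bd]|/nonemptyPn b0] := pselect (b !=set0).
    by exists d.+1 => d' _; exists d.
  by exists 0 => d; rewrite b0.
have [N1 h1] := ih (b `&` [set d | e d n]).
have [N2 h2] := ih (b `&` [set d | ~~ e d n]).
exists (maxn N1 N2) => d bd; case: (boolP (e d n)) => den.
- have [//|d' [bd' d'n] [lt dd']] := h1 d; exists d' => //.
  split; first by lia.
  by move=> i; rewrite ltnS leq_eqVlt => /orP[/eqP->|/dd'//]; rewrite den d'n.
- have [//|d' [bd' d'n] [lt dd']] := h2 d; exists d' => //.
  split; first by lia.
  move=> i; rewrite ltnS leq_eqVlt => /orP[/eqP->|/dd'//].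
  by rewrite (negbTE den) (negbTE d'n).
Qed.

Lemma finite_cells_from n b M : exists N, forall d, b d -> M <= d ->
  exists2 d', b d' & (M <= d') && (d' < N) /\ agree n (e d) (e d').
Proof.
have [N h] := finite_cells n (b `&` [set d | M <= d]).
exists N => d bd Md; have [//|d' [bd' Md'] [d'N dd']] := h d.
by exists d' => //; rewrite Md' d'N.
Qed.

Definition infinite_cell n x := forall M, exists2 d, M <= d & agree n (e d) x.

(** Finitely many cells of level [n] are finite, so their indices are bounded. *)
Lemma infinite_cell_eventually n :
  exists H, forall d, H <= d -> infinite_cell n (e d).
Proof.
have [N h] := finite_cells n [set d | ~ infinite_cell n (e d)].
have [M hM] : exists M, forall d', d' < N -> ~ infinite_cell n (e d') ->
    forall d, M <= d -> ~ agree n (e d) (e d').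
  elim: N {h} => [|N [M hM]]; first by exists 0.
  have [inf|/existsNP[M' nM']] := pselect (infinite_cell n (e N)).
    exists M => d'; rewrite ltnS leq_eqVlt => /orP[/eqP-> //|]; exact: hM.
  exists (maxn M M') => d'; rewrite ltnS leq_eqVlt => /orP[/eqP-> _ d dM dN|].
    by apply: nM'; exists d => //; lia.
  by move=> /hM h /h {}h d dM; apply: h; lia.
exists M => d Md; apply: contrapT => /[dup] nd /h[d' nd' [d'N dd']].
exact: (hM d' d'N nd' d).
Qed.

(** Only the cell of [x] matters, which makes the bound uniform in [x]. Such windows will supply
    finite sets of arbitrarily late indices. *)
Lemma window_bound n M : exists N, forall x, infinite_cell n x ->
  exists2 d, (M <= d) && (d < N) & agree n (e d) x.
Proof.
have [N h] := finite_cells_from n setT M.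
exists N => x /(_ M)[d Md dx]; have [//|//|d' _ [d'N dd']] := h d.
by exists d' => //; apply: agree_trans dx; apply: agree_sym.
Qed.

Lemma approximation K : (forall x, K x -> forall n, infinite_cell n x) ->
  exists2 c, converges c K &
    forall x, K x -> forall n, exists2 d, c d & agree n (e d) x.
Proof.
move=> Kinf; have [N hN] := choice (fun m => window_bound m m).
(* Block [m] takes from the window [[m, N m)] the indices [m]-close to [K]. Closeness at level [n]
   can fail only in the blocks before [n], which are bounded. *)
exists [set d | exists m, m <= d < N m /\ exists2 x, K x & agree m (e d) x].
- move=> n; exists (\max_(m < n) N m) => d [m [/andP[md dN] [x Kx dx]]] Nd.
  exists x => //; apply: agree_le dx; rewrite leqNgt; apply/negP => mn.
  have := leq_trans dN (leq_trans (@leq_bigmax _ (fun i : 'I_n => N i) (Ordinal mn)) Nd).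
  by rewrite ltnn.
- move=> x Kx n; have [d dn dx] := hN n x (Kinf _ Kx n).
  by exists d => //; exists n; split=> //; exists x.
Qed.

(** Otherwise a set [c] approximating the positive part is in [J]. A separating digit is then false
    on [c] but true at some positive point of [b], which [c] approximates. *)
Lemma not_small_positive_part b : ~ J b -> ~ small (positive_part b).
Proof.
move=> nJb small_b.
have [x bx n M|c cb bc] := @approximation (positive_part b).
  by have [d [_ Md dx]] := positive_part_unbounded n M bx; exists d.
have [n [cn /positive_part_nonempty[x xn]]] := sepJ (small_b _ cb) nJb.
have [d [[_ dn] _ dx]] := positive_part_unbounded n.+1 0 xn.
have [|d' cd' d'x] := bc x _ n.+1.
  by apply: positive_part_sub xn => k [].
by move: dn; rewrite /= dx// -d'x// cn.
Qed.

(** Baire category in the closed set [positive_part b]: a small closed set contains no relatively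
    open piece, because such a piece contains the positive part of a cell outside [J]. *)
Lemma baire_positive_part b (K : nat -> set (nat -> bool)) : ~ J b ->
  (forall n, limit_closed (K n)) -> (forall n, small (K n)) ->
  exists2 x, positive_part b x & forall n, ~ K n x.
Proof.
move=> nJb Kcl Ksm.
(* A state is a positive point with the length of a cylinder around it; the next cylinder is longer
   and misses [K n]. *)
pose A := {p : (nat -> bool) * nat | positive_part b p.1}.
pose R n (p q : A) := [/\ agree (sval p).2 (sval p).1 (sval q).1,
  (sval p).2 < (sval q).2 &
  forall y, agree (sval q).2 (sval q).1 y -> ~ K n y].
have Rex n (p : A) : exists q, R n p q.
  case: p => -[x m] /= bx.
  have [y by_ Ky] : exists2 y, positive_part b y & agree m x y /\ ~ K n y.
    apply: contrapT => h.
    apply: (@not_small_positive_part (cell b m x)); first exact: bx.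
    apply: small_sub (Ksm n) => y /positive_part_cell[by_ /= yx].
    by apply: contrapT => nKy; apply: h; exists y => //; split=> //; apply: agree_sym.
  case: Ky => xy nKy.
  have [l hl] : exists l, forall z, agree l y z -> ~ K n z.
    apply: contrapT => /forallNP h; apply/nKy/(Kcl n) => l.
    have /existsNP[z /not_implyP[yz /contrapT Kz]] := h l; by exists z.
  exists (exist _ (y, maxn l m.+1) by_); split=> //=; first by lia.
  by move=> z yz; apply: hl; apply: agree_le yz; lia.
have [x0 bx0] := positive_part_nonempty nJb.
have [f [f0 fR]] := dependent_choice_seq (exist _ (x0, 0) bx0 : A) Rex.
have len n : n <= (sval (f n)).2.
  by elim: n => // n ih; apply: leq_ltn_trans ih _; case: (fR n).
have [||y hy] := @agree_limit _ (fun n => (sval (f n)).1)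
  (fun n => (sval (f n)).2) len.
- by move=> n; case: (fR n) => _ /ltnW.
- by move=> n; case: (fR n).
exists y => [|n]; last by case: (fR n) => _ _; apply; apply: hy.
apply: positive_part_closed => n; exists (sval (f n)).1.
  exact: (svalP (f n)).
by apply/agree_sym/(agree_le (len n)).
Qed.

Lemma positive_part_converges b K : limit_closed K -> converges b K ->
  positive_part b `<=` K.
Proof.
move=> Kcl bK x bx; apply: Kcl => n; have [N h] := bK n.
have [d [bd Nd dx]] := positive_part_unbounded n N bx.
have [y Ky dy] := h d bd Nd; exists y => //.
exact: agree_trans (agree_sym dx) dy.
Qed.

Lemma small_bigcup (K : set (nat -> bool)) (F : nat -> set (nat -> bool)) :
  limit_closed K -> (forall n, limit_closed (F n)) -> (forall n, small (F n)) ->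
  K `<=` \bigcup_n F n -> small K.
Proof.
move=> Kcl Fcl Fsm KF b bK; apply: contrapT => nJb.
have [x /(positive_part_converges Kcl bK)/KF[n _ Fx] nF] :=
  baire_positive_part nJb Fcl Fsm.
exact: (nF n).
Qed.

(** Tallness puts an infinite member [a] of [J] inside [b]. If [b] were outside [J], a separating
    digit would be false along [a] and true along part of [b], yet both converge to [x]. *)
Lemma small1 x : small [set x].
Proof.
move=> b bx; apply: contrapT => nJb.
have [a [ab infa Ja]] : exists a, [/\ a `<=` b, infinite_set a & J a].
  apply: tallJ => /finite_seqP[s bs]; apply: nJb.
  apply: (@J_bounded _ (\max_(i <- s) i).+1) => d; rewrite bs /= => ds.
  by rewrite ltnS; apply: (@leq_bigmax_seq _ _ predT id).
have [n [an bn]] := sepJ Ja nJb.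
have [N hN] := bx n.+1.
have [d [bd dn] /(hN _ bd)[_ -> dx]] := notJ_unbounded N bn.
have [d' ad' /(hN _ (ab _ ad'))[_ -> d'x]] := infinite_unbounded N infa.
by move: dn; rewrite /= dx// -d'x// an.
Qed.

(** A set [c] outside [J] cannot converge to the points of some [b] in [J]: a separating digit would
    be false on [b] and true at arbitrarily late indices of [c]. Conversely, [b] converges to its
    own image. *)
Lemma J_small b : J b <-> small (e @` b).
Proof.
split=> [Jb c cb|]; last first.
  by apply => n; exists 0 => d bd _; exists (e d) => //; exists d.
apply: contrapT => nJc; have [n [bn cn]] := sepJ Jb nJc.
have [N hN] := cb n.+1.
have [d [cd dn] /(hN _ cd)[_ [k bk <-] dk]] := notJ_unbounded N cn.
by move: dn; rewrite /= dk// bn.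
Qed.

(** * The Hurewicz scheme *)

Variable f : (nat -> nat) -> nat -> bool.
Hypothesis f_continuous :
  forall x n, exists m, forall y, agree m x y -> agree n (f x) (f y).
Hypothesis f_range : forall b, ~ J b <-> exists x, b = [set d | f x d].

Implicit Types (w : nat -> nat * nat).

(* A point [w] codes a set [coded w] outside [J] together with a sequence
   [height w] of thresholds; admissibility makes the level-[n] trace of the
   limit set of [coded w] readable from a finite part of [w]. *)
Definition coded w := f (fun i => (w i).1).
Definition height w n := (w n).2.

Definition admissible w :=
  [/\ forall n d, height w n <= d -> infinite_cell n (e d),
      forall n, height w n <= height w n.+1
    & forall n d, coded w d -> height w n <= d ->
      exists2 d', coded w d' &
        (height w n <= d') && (d' < height w n.+1) /\ agree n (e d) (e d')].

Definition inside n w K :=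
  forall d, coded w d -> height w n <= d -> exists2 x, K x & agree n (e d) x.

Lemma notJ_coded w : ~ J [set d | coded w d].
Proof. by apply/f_range; eexists. Qed.

Lemma coded_continuous w n :
  exists m, forall w', agree m w w' -> agree n (coded w) (coded w').
Proof.
have [m h] := f_continuous (fun i => (w i).1) n.
by exists m => w' ww'; apply: h => i /ww' ->.
Qed.

Lemma height_mono w n m : admissible w -> n <= m -> height w n <= height w m.
Proof.
case=> _ hS _ /subnKC <-; elim: (m - n) => [|k ih]; first by rewrite addn0.
by rewrite addnS (leq_trans ih).
Qed.

(** Each instance of admissibility depends on finitely many values of [w], the witness [d'] being
    bounded by [height w n.+1]. *)
Lemma admissible_limit (u : nat -> nat -> nat * nat) (l : nat -> nat) w :
  (forall n, n <= l n) -> (forall n, agree (l n) (u n) w) ->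
  (forall n, admissible (u n)) -> admissible w.
Proof.
move=> nl uw uadm.
have hE n m : n < m -> height (u m) n = height w n.
  by move=> nm; rewrite /height (uw m n)//; apply: leq_trans (nl m).
split=> [n d|n|n d wd].
- by rewrite -(hE n n.+1)//; case: (uadm n.+1) => + _ _; apply.
- by rewrite -!(hE _ n.+2)//; case: (uadm n.+2).
- move=> hd; pose M := maxn d.+1 (height w n.+1).
  have [m hm] := coded_continuous w M; pose j := maxn m n.+2.
  have uj : agree M (coded (u j)) (coded w).
    apply/agree_sym/hm/agree_sym/(agree_le _ (uw j)).
    exact: leq_trans (leq_maxl _ _) (nl j).
  have jn : n.+1 < j by rewrite leq_maxr.
  case: (uadm j) => _ _ /(_ n d); rewrite !hE ?(ltnW jn)// => /(_ _ hd)[|d' d'j [d'n dd']].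
    by rewrite uj// leq_maxl.
  exists d' => //; rewrite -uj//; case/andP: d'n => _ /leq_trans; apply.
  exact: leq_maxr.
Qed.

Lemma not_small_inside K : ~ small K ->
  exists2 w, admissible w & forall n, inside n w K.
Proof.
move=> /existsNP[b /not_implyP[bK nJb]]; have [x bx] := (f_range b).1 nJb.
have [H HH] := choice infinite_cell_eventually.
have [M HM] := choice bK.
(* The next height lies beyond the thresholds for infinite cells and for closeness to [K], and
   beyond representatives of all cells that [b] meets after the previous height. *)
pose R n (p q : nat) := [/\ p <= q, maxn (H n.+1) (M n.+1) <= q &
  forall d, b d -> p <= d -> exists2 d', b d' &
    (p <= d') && (d' < q) /\ agree n (e d) (e d')].
have [n p|h [h0 hR]] := @dependent_choice_seq _ R (maxn (H 0) (M 0)).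
  have [N hN] := finite_cells_from n b p.
  exists (maxn (maxn p N) (maxn (H n.+1) (M n.+1))); split; [lia|lia|].
  move=> d bd pd; have [d' bd' [/andP[pd' d'N] dd']] := hN d bd pd.
  by exists d' => //; split=> //; lia.
have hHM n : maxn (H n) (M n) <= h n.
  by case: n => [|n]; [rewrite h0|case: (hR n)].
have cw : [set d | coded (fun i => (x i, h i)) d] = b by rewrite bx.
exists (fun i => (x i, h i)) => [|n d].
- split=> [n d hd|n|n d cd hd].
  + by apply: HH; rewrite /height /= in hd; have := hHM n; lia.
  + by case: (hR n).
  + have [_ _ /(_ d)] := hR n; rewrite -cw => /(_ cd hd)[d' cd' h']; by exists d'.
- rewrite /height /= => cd hd; apply: HM; last by have := hHM n; lia.
  by rewrite -cw.
Qed.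

(** Closedness in the upper Vietoris topology, whose basic open sets consist of the sets contained
    in a given open set. *)
Definition upward_closed (C : set (set (nat -> bool))) := forall K,
  (forall n, exists2 L, C L & forall x, L x -> exists2 y, K y & agree n x y) ->
  C K.

(** The negligible sets of codes for the derivative: every closed set that captures an admissible
    code in [Q] belongs to one of countably many closed families whose closed members are not
    small. *)
Definition covered (Q : set (nat -> nat * nat)) :=
  exists C : nat -> set (set (nat -> bool)),
  [/\ forall k, upward_closed (C k),
      forall k K, limit_closed K -> C k K -> ~ small K
    & forall w, Q w -> admissible w -> forall K, limit_closed K ->
      (forall n, inside n w K) -> exists k, C k K].

Lemma covered0 : covered set0.
Proof. by exists (fun=> set0); split=> // k K /(_ 0)[]. Qed.

Lemma covered_sub (Q Q' : set (nat -> nat * nat)) :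
  Q `<=` Q' -> covered Q' -> covered Q.
Proof. by move=> QQ' [C [? ? h]]; exists C; split=> // w /QQ'; apply: h. Qed.

Lemma covered_bigcup (Q : nat -> set (nat -> nat * nat)) :
  (forall n, covered (Q n)) -> covered (\bigcup_n Q n).
Proof.
move=> /choice[C hC].
exists (fun m => if (unpickle m : option (nat * nat)) is Some p then C p.1 p.2
                 else set0); split=> [k|k K|w [n _ Qw] wadm K Kcl wK].
- case: (unpickle k) => [p|]; last by move=> K /(_ 0)[].
  by case: (hC p.1).
- by case: (unpickle k) => [p|//]; case: (hC p.1) => _ + _; apply.
- have [_ _ /(_ w Qw wadm K Kcl wK)[k Ck]] := hC n.
  by exists (pickle (n, k)); rewrite pickleK.
Qed.

(** What remains when all covered cylinders are removed, as in the Cantor-Bendixson argument. *)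
Definition kernel := [set w | admissible w /\
  forall n, ~ covered [set w' | agree n w w']].

Lemma covered_kernelC : covered (~` kernel).
Proof.
pose cyl (s : seq (nat * nat)) := [set w | mkseq w (size s) = s].
pose Q m := if (unpickle m : option (seq (nat * nat))) is Some s
  then (if `[< covered (cyl s) >] then cyl s else set0) else set0.
have : covered (\bigcup_n Q n).
  apply: covered_bigcup => n; rewrite /Q; case: (unpickle n) => [s|].
    by case: asboolP => // _; exact: covered0.
  exact: covered0.
move=> [C [C1 C2 C3]]; exists C; split=> // w nkw wadm; apply: C3 => //.
have /existsNP[n /contrapT cov] : ~ forall n, ~ covered [set w' | agree n w w'].
  by move=> h; apply: nkw; split.
exists (pickle (mkseq w n)) => //; rewrite /Q pickleK; case: asboolP => [_|[]].
  by rewrite /cyl /= size_mkseq.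
apply: covered_sub cov => w'; rewrite /cyl /= size_mkseq => h.
exact/agree_mkseq.
Qed.

(** Otherwise the sets [K] approached by kernel points of the cylinder form a closed family without
    small closed members. With a cover of the complement of the kernel, it would cover the
    cylinder. *)
Lemma kernel_small w0 l : kernel w0 -> exists K, [/\ limit_closed K, small K &
  forall n, exists2 w, kernel w & agree l w0 w /\ inside n w K].
Proof.
move=> [_ /(_ l) ncov]; apply: contrapT => nex; apply: ncov.
pose Q n := if n is 0 then kernel `&` [set w | agree l w0 w] else ~` kernel.
apply: (@covered_sub _ (\bigcup_n Q n)).
  move=> w w0w; have [kw|nkw] := pselect (kernel w); first by exists 0.
  by exists 1.
apply: covered_bigcup => -[|n]; last exact: covered_kernelC.
exists (fun=> [set K | forall n, exists2 w, kernel w &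
  agree l w0 w /\ inside n w K]); split=> [_ K h n|_ K Kcl CK Ksm|].
- have [L /(_ n)[w kw [w0w wL]] LK] := h n; exists w => //; split=> // d wd hd.
  have [x /LK[y Ky xy] dx] := wL d wd hd; exists y => //.
  exact: agree_trans dx xy.
- by apply: nex; exists K.
- by move=> w [kw w0w] _ K _ wK; exists 0 => n; exists w.
Qed.

Lemma kernel0_cover : kernel = set0 ->
  exists C : nat -> set (set (nat -> bool)), (forall k, upward_closed (C k)) /\
  forall K, limit_closed K -> ~ small K <-> exists k, C k K.
Proof.
move=> k0; have [C [C1 C2 C3]] := covered_kernelC; exists C; split=> // K Kcl.
split=> [/not_small_inside[w wadm wK]|[k CK]]; last exact: C2 CK.
by apply: C3 wadm _ Kcl wK; rewrite k0.
Qed.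

(** * The tree of kernel points and small sets *)

Record node := Node {
  point : nat -> nat * nat ; depth : nat ;
  part : set (nat -> bool) ; level : nat }.

(** The cylinder of length [depth] around the point contains kernel points whose coded sets are as
    close to [part] as desired. *)
Definition good_node (a : node) := [/\ kernel (point a), limit_closed (part a),
  small (part a) & forall n, level a <= n -> exists2 w, kernel w &
    agree (depth a) (point a) w /\ inside n w (part a)].

Definition near K n L := forall x : nat -> bool, K x ->
  exists2 y, L y & agree n x y.

Lemma near_trans K n L m L' : n <= m -> near K m L -> near L n L' -> near K n L'.
Proof.
move=> nm KL LL' x /KL[y /LL'[z Lz yz] xy]; exists z => //.
exact: agree_trans (agree_le nm xy) yz.
Qed.

(** The coded set of the child is close to the part of its parent, with precision growing with [k].
    The depth of the child fixes that set up to the height of its level, so this finite trace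
    survives in all later nodes. *)
Definition child (a : node) k (b : node) :=
  [/\ good_node b, level b = (k + level a).+1,
      agree (depth a) (point a) (point b) & depth a < depth b] /\
  [/\ level b < depth b,
      forall w, agree (depth b) (point b) w ->
        agree (height (point b) (level b)) (coded (point b)) (coded w),
      inside (k + level a) (point b) (part a)
    & near (part b) (k + level a) (part a)].

Lemma child_exists (a : node) k : good_node a -> exists b : node, child a k b.
Proof.
case=> ka acl asm /(_ (k + level a) (leq_addl _ _))[w kw [aw wa]].
set n := k + level a in wa *.
have [m hm] := coded_continuous w (height w n.+1).
pose l := maxn (maxn (depth a).+1 n.+2) m.
have [K [Kcl Ksm hK]] := kernel_small l kw.
(* Cutting [K] down to the [n]-neighbourhood of [part a] makes the parts of the children tend to
   [part a] from above as [k] grows. *)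
exists (Node w l (K `&` [set x | exists2 y, part a y & agree n x y]) n.+1).
split; split=> //=; [|by rewrite /l; lia|by rewrite /l; lia| |by move=> x []].
- split=> //=.
  + move=> x h; split.
      by apply: Kcl => i; have [y [Ky _] xy] := h i; exists y.
    have [y [_ [z az yz]] xy] := h n; exists z => //; exact: agree_trans xy yz.
  + by apply: small_sub Ksm => x [].
  + move=> i ni; have [w' kw' [ww' w'K]] := hK i; exists w' => //; split=> //.
    move=> d w'd hd; have [x Kx dx] := w'K d w'd hd; exists x => //.
    split=> //=.
    (* The cut loses nothing: the level-[n] cell of [d] is met by [coded w'] between heights [n] and
       [n.+1], where [w] codes the same indices and is close to [part a]. *)
    have aw' := proj1 kw'.
    have [_ _ /(_ n d w'd)[|d' w'd' [/andP[nd' d'n] dd']]] := aw'.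
      by apply: leq_trans hd; apply: height_mono => //; lia.
    have hE j : j <= n.+1 -> height w' j = height w j.
      by move=> jn; rewrite /height ww'//; rewrite /l; lia.
    rewrite !hE// in nd' d'n.
    have [|y ay d'y] := wa d' _ nd'.
      by rewrite (hm w')//; apply: agree_le ww'; rewrite leq_maxr.
    exists y => //; apply: agree_trans d'y; apply: agree_trans dd'.
    by apply/agree_sym; apply: agree_le dx; lia.
- by move=> w' ww'; apply: hm; apply: agree_le ww'; rewrite leq_maxr.
Qed.

(** The bound [pickle s <= d] lets only finitely many [s] contribute to an index, which will make
    the map from trees to sets of indices continuous. *)
Lemma hurewicz_scheme : kernel !=set0 ->
  exists G : seq nat -> set nat, (forall s d, G s d -> pickle s <= d) /\
  forall T : set (seq nat), (forall s t, T (s ++ t) -> T s) ->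
    J (\bigcup_(s in T) G s) <-> ~ exists x, forall n, T (mkseq x n).
Proof.
move=> [w0 kw0]; have [K0 [K0cl K0sm hK0]] := kernel_small 0 kw0.
have [p|next hnext] := @choice _ _
    (fun (p : node * nat) (b : node) => good_node p.1 -> child p.1 p.2 b).
  have [/(child_exists p.2)[b pb]|ng] := pselect (good_node p.1).
    by exists b.
  by exists p.1 => /ng.
pose a0 := Node w0 0 K0 0.
pose nd (s : seq nat) := foldl (fun (a : node) k => next (a, k)) a0 s.
have ndS s k : nd (rcons s k) = next (nd s, k) by rewrite /nd foldl_rcons.
have good s : good_node (nd s).
  elim/last_ind: s => [|s k ih]; first by split.
  by rewrite ndS; case: (hnext (_, k) ih) => -[].
have chd s k : child (nd s) k (nd (rcons s k)) by rewrite ndS; exact: (hnext (nd s, k) (good s)).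
have [N hN] := choice (fun p => window_bound p.1 p.2).
(* The level at which the node was compared with its parent; it is 0 at the root. *)
pose lv s := (level (nd s)).-1.
(* [G s] copies the finite trace of the coded set at level [lv s] into a window starting at
   [pickle s]; by admissibility the cells concerned are infinite, so the window meets them. *)
pose G s := [set d | (pickle s <= d) && (d < N (lv s, pickle s)) /\
  exists d', [/\ coded (point (nd s)) d',
    (height (point (nd s)) (lv s) <= d') &&
    (d' < height (point (nd s)) (lv s).+1) & agree (lv s) (e d) (e d')]].
have lvE s k : lv (rcons s k) = k + level (nd s).
  by rewrite /lv; case: (chd s k) => -[_ -> _ _].
have Gnear s k : near (e @` G (rcons s k)) (k + level (nd s)) (part (nd s)).
  move=> _ [d [_ [d' [cd' /andP[hd' _] dd']]] <-].
  have [_ [_ _ ins _]] := chd s k; rewrite lvE in hd' dd'.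
  by have [x px d'x] := ins d' cd' hd'; exists x => //; apply: agree_trans d'x.
have levS s t : level (nd s) <= level (nd (s ++ t)).
  elim/last_ind: t => [|t j ih]; first by rewrite cats0.
  by rewrite -rcons_cat; case: (chd (s ++ t) j) => -[_ -> _ _]; lia.
have levk s k t : k + level (nd s) < level (nd (rcons s k ++ t)).
  by have := levS (rcons s k) t; case: (chd s k) => -[_ -> _ _].
have pnear s k t :
    near (part (nd (rcons s k ++ t))) (k + level (nd s)) (part (nd s)).
  elim/last_ind: t => [|t j ih].
    by rewrite cats0; case: (chd s k) => _ [].
  have [_ [_ _ _ pj]] := chd (rcons s k ++ t) j.
  by rewrite -rcons_cat; apply: near_trans pj ih; have := levk s k t; lia.
have Gnear' s k t : near (e @` G (rcons s k ++ t)) (k + level (nd s)) (part (nd s)).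
  elim/last_ind: t => [|t j ih]; first by rewrite cats0; apply: Gnear.
  rewrite -rcons_cat; apply: near_trans (Gnear _ _) (pnear s k t).
  by have := levk s k t; lia.
exists G; split=> [s d [/andP[]]//|T Tpre]; split=> [Jb [x Tx]|wf].
(* Along a branch of [T] the points converge to an admissible [w]. If the union is in [J], some
   digit [m] separates it from [coded w]; at a level beyond [m], an index of [coded w] with digit
   [m] true is copied into some [G s]. *)
- pose u n := point (nd (mkseq x n)); pose l n := depth (nd (mkseq x n)).
  have chx n : child (nd (mkseq x n)) (x n) (nd (mkseq x n.+1)).
    by rewrite mkseqS; apply: chd.
  have lS n : l n < l n.+1 by case: (chx n) => -[].
  have nl n : n <= l n by elim: n => // n ih; apply: leq_ltn_trans ih (lS n).
  have [||w hw] := @agree_limit _ u l nl.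
  + by move=> n; apply: ltnW.
  + by move=> n; case: (chx n) => -[].
  have adm : admissible w.
    by apply: admissible_limit nl hw _ => n; case: (good (mkseq x n)) => -[].
  have [m [bm cm]] := sepJ Jb (@notJ_coded w).
  have levn n : n <= level (nd (mkseq x n)).
    elim: n => // n ih; case: (chx n) => -[_ -> _ _] _; lia.
  pose n := x m.+1 + level (nd (mkseq x m.+1)).
  have nm : m < n by have := levn m.+1; rewrite /n; lia.
  have [d [cd dm] hd] := notJ_unbounded (height w n) cm.
  have [hinf _ hclose] := adm.
  have [d' cd' [/andP[nd' d'n] dd']] := hclose n d cd hd.
  have [[_ lvE' _ _] [lvd det _ _]] := chx m.+1.
  have uE j : j <= n.+1 -> height (u m.+2) j = height w j.
    move=> jn; rewrite /height (hw m.+2)//; apply: leq_ltn_trans jn _.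
    by move: lvd; rewrite lvE'.
  have lvn : lv (mkseq x m.+2) = n by rewrite mkseqS lvE.
  have [d'' d''N d''d'] := hN (n, pickle (mkseq x m.+2)) (e d') (hinf n d' nd').
  have bd'' : (\bigcup_(s in T) G s) d''.
    exists (mkseq x m.+2) => //; split; first by rewrite lvn.
    exists d'; rewrite lvn; split=> //; last by rewrite !uE// nd'.
    have := det w (hw m.+2); rewrite lvE' -/(u m.+2) uE// => -> //.
  have := bm _ bd''; rewrite (d''d' m nm) -(dd' m nm) => dm'.
  by move: dm; rewrite /= dm'.
(* Baire category gives a positive point [y] of the union outside all the parts. If [y] is positive
   below [s], it is positive below some child of [s], and following such children yields a branch of
   [T]. *)
- apply: contrapT => nJ.
  have [m| |y yb yK] :=
      @baire_positive_part _ (fun m => if (unpickle m : option (seq nat))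
    is Some s then part (nd s) else set0) nJ.
  + case: (unpickle m) => [s|]; last by move=> ? /(_ 0)[].
    by case: (good s).
  + move=> m; case: (unpickle m) => [s|]; first by case: (good s).
    by apply: small_sub (@small1 (fun=> true)).
  have {}yK s : ~ part (nd s) y by have := yK (pickle s); rewrite pickleK.
  pose below s := \bigcup_(t in [set t | T (s ++ t)]) G (s ++ t).
  have step s : positive_part (below s) y -> exists k, positive_part (below (rcons s k)) y.
    move=> ys.
    have [m hm] : exists m, forall x, part (nd s) x -> ~ agree m y x.
      apply: contrapT => /forallNP h; apply: (yK s).
      have [_ pcl _ _] := good s; apply: pcl => n.
      by have /existsNP[x /not_implyP[px /contrapT yx]] := h n; exists x.
    have fin M : positive_part (\bigcup_(k in `I_M) below (rcons s k)) y ->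
        exists k, positive_part (below (rcons s k)) y.
      elim: M => [|M ih] h.
        by have [d [[]]] := positive_part_unbounded 0 0 h.
      have : positive_part (\bigcup_(k in `I_M) below (rcons s k)
          `|` below (rcons s M)) y.
        apply: positive_part_sub h => d [k /= kM dk].
        move: kM; rewrite ltnS leq_eqVlt => /orP[/eqP kM|kM].
          by right; rewrite -kM.
        by left; exists k.
      by move=> /positive_part_setU[/ih//|]; exists M.
    (* From [k = m] on, everything below the child [k] is [m]-close to [part (nd s)], hence away
       from [y]. Passing to a tail discards the finite set [G s]. *)
    apply: (fin m) => n; have := ys (maxn n m).
    move=> /(@notJ_tail _ (N (lv s, pickle s))); apply: notJ_sub.
    move=> d [[[t /= Tst Gd] dy] Nd]; split; last first.
      by apply: agree_le dy; rewrite leq_maxl.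
    case: t => [|k t] in Tst Gd *.
      rewrite cats0 in Gd; case: Gd => /andP[_]; rewrite ltnNge.
      by rewrite Nd.
    rewrite -cat_rcons in Tst Gd; exists k; last by exists t.
    rewrite /= ltnNge; apply/negP => mk.
    have [|x px dx] := Gnear' s k t (e d); first by exists d.
    apply: hm px _; apply: agree_trans (agree_sym _) (agree_le _ dx).
      by apply: agree_le dy; rewrite leq_maxr.
    lia.
  have [s|g hg] := @choice _ _ (fun s k => positive_part (below s) y ->
      positive_part (below (rcons s k)) y).
    have [/step[k hk]|ns] := pselect (positive_part (below s) y).
      by exists k.
    by exists 0 => /ns.
  pose p := nat_rect (fun _ => seq nat) [::] (fun _ s => rcons s (g s)).
  apply: wf; exists (fun n => g (p n)) => n.
  have pE j : mkseq (fun n => g (p n)) j = p j.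
    by elim: j => // j ih; rewrite mkseqS ih.
  have py j : positive_part (below (p j)) y.
    elim: j => [|j ih]; last exact: hg.
    by apply: positive_part_sub yb => d [s Ts Gs]; exists s.
  rewrite pE; have [d [[t Tt _] _ _]] := positive_part_unbounded 0 0 (py n).
  exact: Tpre Tt.
Qed.

End CountablySeparatedIdeals.

(** * The closure of a sequence in the Cantor space *)

(* The closure of the range of [e] in the Cantor space; [R] is a phantom
   argument, the field in which distances are measured. *)
Definition closed_range (R : realType) (e : nat -> nat -> bool) :=
  {x : nat -> bool | forall n, exists k, agree n (e k) x}.

HB.instance Definition _ R e := gen_eqMixin (closed_range R e).
HB.instance Definition _ R e := gen_choiceMixin (closed_range R e).

Section ClosedRangeMetric.
Local Open Scope ring_scope.
Variables (R : realType) (e : nat -> nat -> bool).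
Local Notation X := (closed_range R e).
Implicit Types x y z : X.

Lemma closed_range_inj x y : sval x = sval y -> x = y.
Proof.
by case: x y => [x hx] [y hy] /= xy; subst y; congr exist; apply: Prop_irrelevance.
Qed.

Definition first_diff_dist x y : R :=
  if pselect (exists n, sval x n != sval y n) is left h
  then (ex_minn h).+1%:R^-1 else 0.

Lemma first_diff_distP x y :
  (x = y /\ first_diff_dist x y = 0) \/
  exists n, [/\ agree n (sval x) (sval y), sval x n <> sval y n
              & first_diff_dist x y = n.+1%:R^-1].
Proof.
rewrite /first_diff_dist; case: pselect => [h|h].
  right; case: ex_minnP => n xy nmin; exists n; split=> //; last exact/eqP.
  move=> i; apply: contraTeq => /nmin; by rewrite -leqNgt.
left; split=> //; apply: closed_range_inj; apply/funext => n.
by apply/eqP; apply: contra_notT h => xy; exists n.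
Qed.

Lemma first_diff_dist_lt x y n :
  first_diff_dist x y < n.+1%:R^-1 <-> agree n.+1 (sval x) (sval y).
Proof.
case: (first_diff_distP x y) => [[-> ->]|[m [xy xym ->]]].
  by split=> // _; rewrite invr_gt0 ltr0n.
rewrite ltf_pV2 ?posrE ?ltr0n// ltr_nat ltnS; split=> [nm|xy'].
  exact: agree_le xy.
by rewrite ltnNge; apply/negP => mn; apply/xym/xy'.
Qed.

Lemma first_diff_distxx x : first_diff_dist x x = 0.
Proof. by case: (first_diff_distP x x) => [[]|[n []]]. Qed.

Lemma first_diff_dist_positivity x y : first_diff_dist x y = 0 -> x = y.
Proof.
case: (first_diff_distP x y) => [[]//|[n [_ _ ->]]] /eqP.
by rewrite invr_eq0 pnatr_eq0.
Qed.

Lemma first_diff_dist_ge0 x y : 0 <= first_diff_dist x y.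
Proof. by case: (first_diff_distP x y) => [[_ ->]|[n [_ _ ->]]]. Qed.

Lemma first_diff_dist_max x y z :
  first_diff_dist x z <= first_diff_dist x y \/
  first_diff_dist x z <= first_diff_dist y z.
Proof.
case: (first_diff_distP x z) => [[_ ->]|[n [_ xz ->]]].
  by left; apply: first_diff_dist_ge0.
case: (leP n.+1%:R^-1 (first_diff_dist x y)) => [|/first_diff_dist_lt xy].
  by left.
case: (leP n.+1%:R^-1 (first_diff_dist y z)) => [|/first_diff_dist_lt yz].
  by right.
by case: xz; rewrite xy// yz.
Qed.

Lemma first_diff_dist_sym x y : first_diff_dist x y = first_diff_dist y x.
Proof.
apply/eqP; rewrite eq_le; apply/andP; split.
  case: (first_diff_distP x y) => [[_ ->]|[n [_ xy ->]]].
    exact: first_diff_dist_ge0.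
  rewrite leNgt; apply/negP => /first_diff_dist_lt yx; apply: xy.
  by rewrite yx.
case: (first_diff_distP y x) => [[_ ->]|[n [_ xy ->]]].
  exact: first_diff_dist_ge0.
rewrite leNgt; apply/negP => /first_diff_dist_lt yx; apply: xy.
by rewrite yx.
Qed.

Lemma first_diff_dist_triangle y x z :
  first_diff_dist x z <= first_diff_dist x y + first_diff_dist y z.
Proof.
case: (first_diff_dist_max x y z) => /le_trans; apply.
  by rewrite lerDl first_diff_dist_ge0.
by rewrite lerDr first_diff_dist_ge0.
Qed.

HB.instance Definition _ := @isMetric.Build R X first_diff_dist
  first_diff_distxx first_diff_dist_positivity first_diff_dist_sym
  first_diff_dist_triangle.

Lemma closed_range_nbhsP x (A : set X) : nbhs x A <->
  exists n, forall y, agree n (sval x) (sval y) -> A y.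
Proof.
rewrite -nbhs_ballE; split=> [[r /= r0 xrA]|[n nA]].
  exists (Num.truncn r^-1).+1 => y xy; apply: xrA.
  rewrite ballEmdist /=.
  have /first_diff_dist_lt/lt_le_trans := xy; apply.
  rewrite -[leRHS]invrK lef_pV2 ?posrE ?ltr0n ?invr_gt0//.
  exact/ltW/truncnS_gt.
exists n.+1%:R^-1 => /=; first by rewrite invr_gt0 ltr0n.
move=> y; rewrite ballEmdist /= => /first_diff_dist_lt xy.
by apply: nA; apply: agree_le xy.
Qed.

Lemma closed_range_closureP (A : set X) x : closure A x <->
  forall n, exists2 y, A y & agree n (sval x) (sval y).
Proof.
split=> [xA n|h B /closed_range_nbhsP[n nB]].
  have [|y [Ay xy]] := xA [set y : X | agree n (sval x) (sval y)].
    by apply/closed_range_nbhsP; exists n.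
  by exists y.
by have [y Ay /nB By] := h n; exists y.
Qed.

Lemma closed_range_open (A : set X) :
  (forall x, A x -> exists n, forall y, agree n (sval x) (sval y) -> A y) ->
  open A.
Proof.
by move=> h; rewrite openE => x /h ?; apply/closed_range_nbhsP.
Qed.

Lemma closed_range_limit_closed (A : set X) :
  closed A -> limit_closed (sval @` A).
Proof.
move=> Acl x h.
have hx n : exists k, agree n (e k) x.
  have [_ [z _ <-] xz] := h n; have [k kz] := svalP z n.
  by exists k; apply: agree_trans kz (agree_sym xz).
exists (exist _ x hx) => //; apply: Acl; apply/closed_range_closureP => n.
by have [_ [y Ay <-] xy] := h n; exists y.
Qed.

(** A cylinder meeting every set of the filter has a half with the same property; the resulting
    branch is a cluster point. *)
Lemma closed_range_compact : compact [set: X].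
Proof.
move=> F FF _.
pose Q s := forall A, F A -> exists2 x, A x & mkseq (sval x) (size s) = s.
have [|s Qs|x Qx] := @konig Q.
- by move=> A FA; have [x Ax] := filter_ex FA; exists x.
- apply: contrapT => /forallNP h.
  have hA b : exists A, F A /\ forall x, A x ->
      mkseq (sval x) (size (rcons s b)) <> rcons s b.
    have /existsNP[A /not_implyP[FA nA]] := h b; exists A; split=> // x Ax xs.
    by apply: nA; exists x.
  have [A [FA nA]] := hA true; have [B [FB nB]] := hA false.
  have [x [Ax Bx] xs] := Qs _ (filterI FA FB).
  have := nA x Ax; have := nB x Bx; rewrite !size_rcons !mkseqS xs.
  by case: (sval x (size s)).
have hx n : exists k, agree n (e k) x.
  have [y _] := Qx n setT filterT; rewrite size_mkseq => /agree_mkseq yx.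
  by have [k ky] := svalP y n; exists k; apply: agree_trans yx.
exists (exist _ x hx); split=> // A B FA /closed_range_nbhsP[n nB].
have [y Ay] := Qx n A FA; rewrite size_mkseq => /agree_mkseq yx.
by exists y; split=> //; apply: nB; apply: agree_sym.
Qed.

Lemma in_closed_range k : forall n, exists k', agree n (e k') (e k).
Proof. by move=> n; exists k. Qed.

Definition range_point k : X := exist _ (e k) (in_closed_range k).

Lemma dense_range_point : dense (range range_point).
Proof.
move=> U [x Ux] Uo.
have /closed_range_nbhsP[n nU] : nbhs x U by apply: open_nbhs_nbhs.
have [k kx] := svalP x n; exists (range_point k); split=> //.
by apply: nU; apply: agree_sym.
Qed.

Lemma closed_range_polish : polish X.
Proof.
split.
  exists (range range_point); last exact: dense_range_point.
  exact: card_image_le.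
move=> F FF Fc; have [x [_ xF]] := @closed_range_compact F FF filterT.
exists x => A /closed_range_nbhsP[n nA].
have [y Fy] : exists y, F (ball y (n.+1%:R^-1 : R)).
  by apply: (cauchyP F).1 => //; rewrite invr_gt0 ltr0n.
have [|z [yz xz]] := xF _ [set z : X | agree n (sval x) (sval z)] Fy.
  by apply/closed_range_nbhsP; exists n.
apply: filterS Fy => t yt; apply: nA; move: yz yt; rewrite ballEmdist /=.
move=> /first_diff_dist_lt/(agree_le (leqnSn n)) yz.
move=> /first_diff_dist_lt/(agree_le (leqnSn n)) yt.
exact: agree_trans xz (agree_trans (agree_sym yz) yt).
Qed.

Lemma closed_range_clopen_basis : clopen_basis X.
Proof.
pose C (x : X) n := [set y : X | agree n (sval x) (sval y)].
have Co x n : open (C x n).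
  apply: closed_range_open => y xy; exists n => z; exact: agree_trans.
exists [set A | exists x n, A = C x n].
  move=> _ [x [n ->]]; split; first exact: Co.
  move=> y /closed_range_closureP/(_ n)[z xz yz].
  exact: agree_trans xz (agree_sym yz).
split=> [_ [x [n ->]]|x A /closed_range_nbhsP[n nA]]; first exact: Co.
by exists (C x n) => //=; split=> //; exists x, n.
Qed.

End ClosedRangeMetric.

(** * From a topological representation to a separating code *)

Section MetricSpaces.
Local Open Scope ring_scope.
Context {R : realType} {X : metricType R}.

Lemma metric_nbhsP (x : X) (A : set X) :
  nbhs x A <-> exists n, ball x (n.+1%:R^-1 : R) `<=` A.
Proof.
rewrite -nbhs_ballE; split=> [[r /= r0 xrA]|[n nA]].
  exists (Num.truncn r^-1); apply: subset_trans xrA; apply: le_ball.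
  by rewrite -[leRHS]invrK lef_pV2 ?posrE ?ltr0n ?invr_gt0// ltW// truncnS_gt.
by exists n.+1%:R^-1 => //=; rewrite invr_gt0 ltr0n.
Qed.

Lemma separable_countable_base : separable X -> exists U : nat -> set X,
  (forall n, open (U n)) /\
  forall x A, nbhs x A -> exists n, U n x /\ U n `<=` A.
Proof.
case=> D /countable_injP[phi phi_inj] Dd.
pose B i n := [set y | exists d, [/\ D d, phi d = i & ball d (n.+1%:R^-1 : R) y]].
exists (fun m => if (unpickle m : option (nat * nat)) is Some p
  then (B p.1 p.2)^° else set0); split=> [m|x A].
  by case: unpickle => [p|]; [exact: open_interior|exact: open0].
rewrite -nbhs_ballE => -[r /= r0 xrA].
have [n nr] : exists n, n.+1%:R^-1 + n.+1%:R^-1 <= r.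
  exists (Num.truncn (r / 2)^-1).
  rewrite [leRHS]splitr; have h : (Num.truncn (r / 2)^-1).+1%:R^-1 <= r / 2.
    rewrite -[leRHS]invrK lef_pV2 ?posrE ?ltr0n ?invr_gt0 ?divr_gt0//.
    by rewrite ltW// truncnS_gt.
  exact: lerD.
have n0 : 0 < n.+1%:R^-1 :> R by rewrite invr_gt0 ltr0n.
(* The radius is halved so that the ball of radius [n.+1%:R^-1] around [d] is a neighbourhood of
   [x]. *)
pose V := (ball x (n.+1%:R^-1 / 2 : R))^°.
have xV : V x by apply: nbhsx_ballx; rewrite divr_gt0.
have [|d [/interior_subset dx Dd']] := Dd V _ (open_interior _).
  by exists x.
exists (pickle (phi d, n)); rewrite pickleK /=; split.
  rewrite /interior; apply: filterS (nbhsx_ballx x (n.+1%:R^-1 / 2) _); last first.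
    by rewrite divr_gt0.
  move=> y xy; exists d; split=> //; rewrite [_^-1]splitr.
  exact: ball_triangle (ball_sym dx) xy.
apply: subset_trans (@interior_subset _ _) _ => y [d' [Dd'' dd' d'y]]; apply: xrA.
have {}dd' : d' = d by apply: phi_inj; rewrite ?inE.
rewrite dd' in d'y; apply: le_ball nr _ _; apply: ball_triangle d'y.
by apply: le_ball dx; rewrite ler_pdivrMr// ler_pMr// ler1n.
Qed.

Lemma metric_separate (x y : X) : x <> y -> exists A B,
  [/\ nbhs x A, nbhs y B & forall z, A z -> B z -> False].
Proof.
move=> xy; apply: contrapT => h; apply/xy/metric_hausdorff => A B xA yB.
by apply: contrapT => AB; apply: h; exists A, B; split=> // z Az Bz; apply: AB; exists z.
Qed.

End MetricSpaces.

Section RepresentedIdeals.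
Context {R : realType} {X : metricType R}.
Variables (I : set (set X)) (D : set X) (rho : nat -> X) (J : set (set nat)).
Hypothesis sepX : separable X.
Hypothesis idealI : sigma_ideal I.
Hypothesis rho_bij : set_bij [set: nat] D rho.
Hypothesis JE : J = [set a | closure_ideal I D (rho @` a)].

Lemma represented_mem a : J a <-> I (closure (rho @` a)).
Proof.
rewrite JE; split=> [[]//|Ia]; split=> // _ [k _ <-].
by case: rho_bij => + _ _; apply.
Qed.

Lemma sigma_ideal_sub (A B : set X) : A `<=` B -> I B -> I A.
Proof. by case: idealI => + _ _; apply. Qed.

Lemma sigma_ideal_countable (A : set X) : countable A -> I A.
Proof.
move=> /countable_injP[phi phi_inj].
apply: (@sigma_ideal_sub _ (\bigcup_n (A `&` [set x | phi x = n]))).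
  by move=> x Ax; exists (phi x).
case: idealI => _ + I1; apply => n.
have [[x [Ax xn]]|ne] := pselect (exists x, A x /\ phi x = n).
  apply: sigma_ideal_sub (I1 x) => y [Ay yn]; apply: phi_inj; rewrite ?inE//.
  by rewrite xn yn.
(* An empty fibre is contained in any singleton; [rho 0] is arbitrary. *)
by apply: sigma_ideal_sub (I1 (rho 0)) => y [Ay yn]; case: ne; exists y.
Qed.

(** Outside [C] the closure adds nothing to the image of [a], so it is countable. *)
Lemma represented_scattered a (C : set X) : countable C ->
  (forall y, ~ C y -> exists2 A, nbhs y A &
     exists N, forall d, a d -> A (rho d) -> d < N) -> J a.
Proof.
move=> Cc h; apply/represented_mem.
apply: (@sigma_ideal_sub _ (rho @` a `|` C)); last first.
  apply: sigma_ideal_countable; rewrite -bigcup2E; apply: bigcup_countable => //.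
  move=> i _; case: i => [|[|i]] //=.
  by apply: sub_countable (card_image_le _ _) _.
move=> y ya; apply: contrapT => /not_orP[nay /h[A yA [N hN]]]; apply: nay.
have [[d [_ ad] <-]|nFy] := pselect ((rho @` (`I_N `&` a)) y).
  by exists d.
have Fcl : closed (rho @` (`I_N `&` a)).
  apply: (accessible_finite_set_closed.1 (hausdorff_accessible (@metric_hausdorff _ X))).
  by apply/finite_image/finite_setIl.
have yF : nbhs y (~` (rho @` (`I_N `&` a))).
  by apply: open_nbhs_nbhs; split=> //; exact: closed_openC.
have [_ [[d ad <-] [Ad nd]]] := ya _ (filterI yA yF).
by exfalso; apply: nd; exists d => //; split=> //=; apply: hN.
Qed.

(** Either the image of [b] has no accumulation point, and [b] itself is in [J], or a subsequence
    converges to a point and its closure is countable. *)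
Lemma represented_tall : tall J.
Proof.
move=> b infb.
have [[x hx]|nx] := pselect (exists x : X, forall A : set X,
    nbhs x A -> forall N, exists d, [/\ b d, N <= d & A (rho d)]); last first.
  exists b; split=> //; apply: (@represented_scattered _ set0) => // y _.
  have /existsNP[A /not_implyP[yA /existsNP[N hN]]] :
      ~ forall A : set X, nbhs y A -> forall N, exists d, [/\ b d, N <= d & A (rho d)].
    by move=> h; apply: nx; exists y.
  exists A => //; exists N => d bd Ad; rewrite ltnNge; apply/negP => Nd.
  by apply: hN; exists d.
have /choice[g hg] : forall n, exists d,
    [/\ b d, n <= d & ball x (n.+1%:R^-1 : R)%R (rho d)].
  by move=> n; apply: hx; apply/metric_nbhsP; exists n.
exists (range g); split.
- by move=> _ [n _ <-]; case: (hg n).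
- move=> /finite_seqP[s gs]; have [_ + _] := hg (\max_(i <- s) i).+1.
  rewrite ltnNge => /negP; apply.
  apply: (@leq_bigmax_seq _ _ predT id) => //.
  by have : range g (g (\max_(i <- s) i).+1) by []; rewrite gs.
- apply: (@represented_scattered _ [set x]) => // y /metric_separate[A [B [yA xB AB]]].
  exists A => //; have /metric_nbhsP[n nB] := xB.
  exists (\max_(i < n) g i).+1 => _ [m _ <-] Am.
  case: (ltnP m n) => mn.
    by rewrite ltnS; apply: (@leq_bigmax _ (fun i : 'I_n => g i) (Ordinal mn)).
  exfalso; apply: AB Am _; apply: nB; have [_ _] := hg m; apply: le_ball.
  by rewrite lef_pV2 ?posrE ?ltr0n// ler_nat.
Qed.

(** If no [U n] separates, each basic set missing the closure of [a] meets [b] in a member of [J].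
    The closures of these members and of [a] then cover the closure of [b], and the sigma-ideal
    contains it. *)
Lemma represented_separated (U : nat -> set X) :
  (forall n, open (U n)) ->
  (forall x A, nbhs x A -> exists n, U n x /\ U n `<=` A) ->
  separating J (fun k n => `[< U n (rho k) >]).
Proof.
move=> Uo Ub a b /represented_mem Ia nJb; apply: contrapT => /forallNP h.
apply/nJb/represented_mem.
pose c n := b `&` [set k | `[< U n (rho k) >]].
pose F m := if m is n.+1 then
  (if `[< I (closure (rho @` c n)) >] then closure (rho @` c n) else set0)
  else closure (rho @` a).
apply: (@sigma_ideal_sub _ (\bigcup_n F n)); last first.
  case: idealI => _ + _; apply => -[|n] //=; case: asboolP => // _.
  exact: sigma_ideal_countable.
move=> x bx; have [ax|nax] := pselect (closure (rho @` a) x); first by exists 0.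
have xo : nbhs x (~` closure (rho @` a)).
  by apply: open_nbhs_nbhs; split=> //; apply: closed_openC; exact: closed_closure.
have [n [Ux UA]] := Ub _ _ xo; exists n.+1 => //=; rewrite asboolT.
  move=> A xA.
  have [_ [[k bk <-] [Uk Ak]]] := bx _ (filterI (open_nbhs_nbhs (conj (Uo n) Ux)) xA).
  by exists (rho k); split=> //; exists k => //; split=> //; apply/asboolP.
apply/represented_mem; apply: contrapT => nJ; apply: (h n); split=> // k ak.
by apply/asboolP => /UA; apply; apply: subset_closure; exists k.
Qed.

Lemma represented_code : exists e : nat -> nat -> bool,
  [/\ injective e, tall J & separating J e].
Proof.
have [U [Uo Ub]] := separable_countable_base sepX.
exists (fun k n => `[< U n (rho k) >]); split.
- move=> k l kl; have [_ /(_ k l) + _] := rho_bij; apply; rewrite ?inE//.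
  apply: contrapT => /metric_separate[A [B [kA lB AB]]].
  have [n [Uk UA]] := Ub _ _ kA; apply: (AB (rho l)); last exact: nbhs_singleton.
  by apply: UA; apply/asboolP; rewrite -(congr1 (@^~ n) kl); apply/asboolP.
- exact: represented_tall.
- exact: represented_separated.
Qed.

End RepresentedIdeals.

(** * Representation by a compact space *)

Section SequenceSpaces.
Context {T : discreteTopologicalType}.
Local Notation S := (prod_topology (fun _ : nat => T)).

Lemma prod_nbhsP (x : S) (A : set S) :
  nbhs x A <-> exists n, forall y : S, agree n x y -> A y.
Proof.
split=> [|[n nA]]; last first.
  apply: (@filterS S (nbhs x) _ [set y : S | agree n x y]) => //.
  elim: n {nA} => [|n ih]; first exact: filterS filterT.
  have : nbhs x [set y : S | y n = x n].
    have := @proj_continuous nat (fun _ => T) n x [set x n].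
    by rewrite nbhs_principalE; apply.
  move=> /(filterI ih); apply: filterS => y [/= xy yn] i.
  by rewrite ltnS leq_eqVlt => /orP[/eqP->|/xy].
pose F : set_system S := filter_from setT (fun n => [set y : S | agree n x y]).
have FF : Filter F.
  apply: filter_from_filter; first by exists 0.
  move=> i j _ _; exists (maxn i j) => // y xy.
  by split; apply: agree_le xy; rewrite ?leq_maxl ?leq_maxr.
suff /[apply] : F --> x by move=> [n _ nA]; exists n.
apply/cvg_sup => i A' [B [[V oV <-] Vx] VA']; exists i.+1 => // y xy.
by apply: VA'; rewrite /= /proj -xy.
Qed.

End SequenceSpaces.

Lemma cantor_nbhsP (x : cantor_space) (A : set cantor_space) :
  nbhs x A <-> exists n, forall y : cantor_space, agree n x y -> A y.
Proof. exact: prod_nbhsP. Qed.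

Lemma baire_nbhsP (x : baire_space) (A : set baire_space) :
  nbhs x A <-> exists n, forall y : baire_space, agree n x y -> A y.
Proof. exact: prod_nbhsP. Qed.

Section Vietoris.
Context {X : topologicalType}.

Lemma vietoris_subbase_open (A : set (hyperspace X)) :
  vietoris_subbase A -> open A.
Proof.
move=> hA; exists [set A]; last by rewrite bigcup_set1.
by move=> _ ->; apply: (finI_from1 id).
Qed.

Lemma vietoris_openP (O : set (hyperspace X)) (K : hyperspace X) :
  open O -> O K -> exists s : seq (set (hyperspace X)),
    [/\ forall A, A \in s -> vietoris_subbase A, forall A, A \in s -> A K
      & forall L, (forall A, A \in s -> A L) -> O L].
Proof.
move=> [D Dsub <-] [A DA AK]; have [B Bsub BA] := Dsub _ DA.
exists (finmap.enum_fset B); split.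
- by move=> C CB; apply: set_mem; exact: (Bsub C CB).
- by move=> C CB; move: AK; change (A K -> C K); rewrite -BA; apply.
- by move=> L hL; exists A => //; change (A L); rewrite -BA => C; exact: hL.
Qed.

End Vietoris.

(** * The sigma-ideal of small compact sets *)

Section CompactRepresentation.
Variables (R : realType) (J : set (set nat)) (e : nat -> nat -> bool).
Hypothesis idealJ : ideal J.
Hypothesis e_inj : injective e.
Hypothesis tallJ : tall J.
Hypothesis sepJ : separating J e.
Local Notation X := (closed_range R e).

Definition small_compact : set (hyperspace X) :=
  [set K | small J e (sval @` sval K)].

Lemma compact_limit_closed (K : hyperspace X) : limit_closed (sval @` sval K).
Proof.
apply: closed_range_limit_closed; apply: compact_closed (svalP K).
exact: (@metric_hausdorff R X).
Qed.

Lemma small_compact_sigma_ideal : compact_sigma_ideal small_compact.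
Proof.
split=> [K L KL|F K FI KF|x K Kx].
- by apply: small_sub; apply: image_subset.
- apply: (small_bigcup idealJ sepJ (F := fun n => sval @` sval (F n))).
  + exact: compact_limit_closed.
  + by move=> n; apply: compact_limit_closed.
  + exact: FI.
  + by move=> _ [x + <-]; rewrite KF => -[n _ Fx]; exists n => //; exists x.
- by rewrite /small_compact /= Kx image_set1; apply: small1.
Qed.

Lemma small_compact_closure a :
  J a <-> small J e (sval @` closure (range_point R e @` a)).
Proof.
rewrite (J_small idealJ sepJ); split=> h b cb.
  apply: h => n; have [N hN] := cb n; exists N => d bd Nd.
  have [_ [x /closed_range_closureP/(_ n)[_ [k ak <-] xk] <-] dx] := hN d bd Nd.
  by exists (e k); [exists k|apply: agree_trans xk].
apply: h => n; have [N hN] := cb n; exists N => d bd Nd.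
have [_ [k ak <-] dk] := hN d bd Nd; exists (e k) => //.
exists (range_point R e k) => //; apply: subset_closure; by exists k.
Qed.

Lemma upward_closed_closed (C : set (set (nat -> bool))) : upward_closed C ->
  open [set K : hyperspace X | ~ C (sval @` sval K)].
Proof.
move=> Cup; rewrite openE => K /= nCK.
have [n hn] : exists n, forall L, C L ->
    ~ forall x, L x -> exists2 y, (sval @` sval K) y & agree n x y.
  apply: contrapT => /forallNP h; apply/nCK/Cup => n.
  have /existsNP[L /not_implyP[CL /contrapT hL]] := h n; by exists L.
pose V : set X := [set y | exists2 x, sval K x & agree n (sval y) (sval x)].
have Vo : open V.
  apply: closed_range_open => y [x Kx yx]; exists n => z yz; exists x => //.
  exact: agree_trans (agree_sym yz) yx.
apply: (@filterS _ _ _ [set L : hyperspace X | sval L `<=` V]).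
  move=> L /= LV CL; apply: (hn _ CL) => _ [y /LV[x Kx yx] <-].
  by exists (sval x) => //; exists x.
apply: open_nbhs_nbhs; split; last by move=> x Kx; exists x.
by apply: vietoris_subbase_open; exists V => //; left.
Qed.

Lemma small_compact_represents : (exists C : nat -> set (set (nat -> bool)),
    (forall k, upward_closed (C k)) /\
    forall K, limit_closed K -> ~ small J e K <-> exists k, C k K) ->
  represented_by_Pi02_compact R J.
Proof.
move=> [C [Cup CE]].
exists X, small_compact, (range (range_point R e)), (range_point R e); split.
- exact: closed_range_compact.
- split; first exact: small_compact_sigma_ideal.
  exists (fun k => [set K : hyperspace X | ~ C k (sval @` sval K)]).
    by move=> k; apply: upward_closed_closed.
  apply/seteqP; split=> K /=.
    by move=> Ks k _ CK; apply/(CE _ (compact_limit_closed (K := K))): Ks; exists k.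
  move=> h; apply: contrapT => /(CE _ (compact_limit_closed (K := K)))[k].
  exact: h.
- exact: sub_countable (card_image_le _ _) _.
- exact: dense_range_point.
- split.
    by split=> // k l _ _ /(congr1 sval)/e_inj.
  apply/seteqP; split=> a /=.
    move=> /small_compact_closure h.
    have cK : compact (closure (range_point R e @` a)).
      apply: (@subclosed_compact _ _ [set: X]) => //; last exact: closed_range_compact.
      exact: closed_closure.
    by exists (exist _ _ cK).
  by move=> [K Ks Ka]; apply/small_compact_closure; rewrite -Ka.
Qed.

End CompactRepresentation.

(** * Hardness *)

Lemma injective_unbounded (g : nat -> nat) M : injective g -> exists m, M <= g m.
Proof.
move=> gi; apply: contrapT => /forallNP h.
have gM m : g m < M by rewrite ltnNge; apply/negP/h.
have := @leq_card 'I_M.+1 'I_M (fun i => Ordinal (gM i)).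
rewrite !card_ord ltnn => /(_ _)/negP; apply => // i j /(congr1 val) /gi ij.
exact: val_inj.
Qed.

(** Digit [n] of [Phi x] depends only on earlier digits, so a fixed point is computed
    recursively. *)
Lemma fixed_point (Phi : (nat -> bool) -> nat -> bool) :
  (forall x y n, agree n x y -> Phi x n = Phi y n) -> exists x, Phi x = x.
Proof.
move=> PhiE.
pose p := nat_rect (fun _ => seq bool) [::]
  (fun n s => rcons s (Phi (nth false s) n)).
pose x n := Phi (nth false (p n)) n.
have px n : p n = mkseq x n by elim: n => // n ih; rewrite mkseqS -ih.
exists x; apply/funext => n; rewrite [RHS]/x; apply: PhiE => i ni.
by rewrite px nth_mkseq.
Qed.

(** A matrix is laid out as one sequence. The forgotten third component makes every position recur
    infinitely often; [(0, 0)] is a default for numbers that are not codes. *)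
Definition position (c : nat) : nat * nat :=
  if (unpickle c : option (nat * nat * nat)) is Some p then p.1 else (0, 0).

Lemma position_cofinal p M : exists2 c, M <= c & position c = p.
Proof.
have [|m Mm] := @injective_unbounded (fun m => pickle (p, m)) M.
  by move=> m m' /(pcan_inj pickleK)[].
by exists (pickle (p, m)) => //; rewrite /position pickleK.
Qed.

Definition finite_columns (z : nat -> bool) :=
  forall i, exists N, forall c, N <= c -> (position c).1 = i -> z c = false.

(** * Reducing Pi^0_3 sets to finiteness of columns *)

Section FiniteColumnsHard.
Context {Y : Type}.
Variables (h : Y -> nat -> bool) (C : nat -> nat -> set Y).
Hypothesis C_closed : forall i j y, ~ C i j y ->
  exists m, forall y', agree m (h y) (h y') -> ~ C i j y'.

(* At stage [n] the digits of [y] known so far exclude [y] from the first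
   [j + 1] sets of the [i]th row. *)
Let excluded i j n y :=
  forall y', agree n (h y) (h y') -> forall k, k <= j -> ~ C i k y'.

Let first_excluded y c := `[< excluded (position c).1 (position c).2 c y /\
  forall c', c' < c -> position c' = position c ->
    ~ excluded (position c).1 (position c).2 c' y >].

Let excluded_le i j n m y : n <= m -> excluded i j n y -> excluded i j m y.
Proof. by move=> nm hy y' /(agree_le nm); apply: hy. Qed.

Let excluded_agree i j n y y' : agree n (h y) (h y') ->
  excluded i j n y -> excluded i j n y'.
Proof. by move=> yy' hy y'' /(agree_trans yy'); apply: hy. Qed.

Let excluded_exists i j y : (forall k, ~ C i k y) -> exists n, excluded i j n y.
Proof.
move=> nC; elim: j => [|j [n hn]].
  have [m hm] := C_closed (nC 0); exists m => y' /hm nC' k.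
  by rewrite leqn0 => /eqP ->.
have [m hm] := C_closed (nC j.+1); exists (maxn n m) => y' yy' k.
rewrite leq_eqVlt => /orP[/eqP->|kj].
  by apply: hm; apply: agree_le yy'; rewrite leq_maxr.
by apply: hn => //; apply: agree_le yy'; rewrite leq_maxl.
Qed.

Let first_excluded_inj y c c' : first_excluded y c -> first_excluded y c' ->
  position c = position c' -> c = c'.
Proof.
move=> /asboolP[ec hc] /asboolP[ec' hc'] cc'.
case: (ltngtP c c') => // [/hc'|/hc]; first by move=> /(_ cc'); rewrite -cc'.
by move=> /(_ (esym cc')); rewrite cc'.
Qed.

Let first_excluded_exists i j y : (forall k, ~ C i k y) ->
  exists c, first_excluded y c /\ position c = (i, j).
Proof.
move=> /(excluded_exists j)[n en]; have [c nc ci] := position_cofinal (i, j) n.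
have ex : exists c, `[< position c = (i, j) /\ excluded i j c y >].
  by exists c; apply/asboolP; split=> //; apply: excluded_le en.
case: (ex_minnP ex) => {nc ci}c /asboolP[ci ec] cmin.
exists c; split=> //; apply/asboolP; rewrite ci; split=> // c' c'c c'i ec'.
have : `[< position c' = (i, j) /\ excluded i j c' y >] by apply/asboolP.
by move=> /cmin; rewrite leqNgt c'c.
Qed.

(** Column [i] receives exactly one digit 1 for each [j] such that [y] lies outside the first
    [j + 1] sets of row [i] and this is detected; it is finite exactly when [y] lies in some set of
    the row. *)
Lemma finite_columns_hard : exists phi : Y -> nat -> bool,
  (forall y y' n, agree n (h y) (h y') -> phi y n = phi y' n) /\
  forall y, (forall i, exists j, C i j y) <-> finite_columns (phi y).
Proof.
exists first_excluded; split=> [y y' n yy'|y].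
  apply: asbool_equiv_eq; split=> -[en hn]; split.
  - exact: excluded_agree yy' en.
  - move=> c cn ci ec; apply: (hn c cn ci); apply: excluded_agree ec.
    by apply/agree_sym; apply: agree_le yy'; apply: ltnW.
  - exact: excluded_agree (agree_sym yy') en.
  - move=> c cn ci ec; apply: (hn c cn ci); apply: excluded_agree ec.
    by apply: agree_le yy'; apply: ltnW.
split=> [hC i|fin i].
  have [j Cj] := hC i.
  have [N hN] : exists N, forall c, (position c).1 = i -> (position c).2 < j ->
      first_excluded y c -> c < N.
    elim: j {Cj} => [|j [N hN]]; first by exists 0.
    have [[c [fc ci]]|nc] :=
        pselect (exists c, first_excluded y c /\ position c = (i, j)).
      exists (maxn N c.+1) => c' c'i; rewrite ltnS leq_eqVlt.
      move=> /orP[/eqP c'j fc'|c'j fc'].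
        rewrite (first_excluded_inj fc' fc); first by rewrite leq_maxr.
        by rewrite ci -c'i -c'j; case: (position c').
      exact: leq_trans (hN _ c'i c'j fc') (leq_maxl _ _).
    exists N => c ci; rewrite ltnS leq_eqVlt => /orP[/eqP cj fc|]; last exact: hN.
    case: nc; exists c; split=> //; rewrite -ci -cj; by case: (position c).
  exists N => c Nc ci; apply/negbTE/negP => fc.
  have : (position c).2 < j.
    rewrite ltnNge; apply/negP => jc; move: fc => /asboolP[ec _].
    by apply: (ec y (@agree_refl _ _ _) j jc); rewrite ci.
  by move=> /(hN c ci)/(_ fc); rewrite ltnNge Nc.
apply: contrapT => /forallNP nC; have [N hN] := fin i.
have /choice[g hg] := fun j => first_excluded_exists j nC.
have [|j Nj] := @injective_unbounded g N.
  move=> j j' gj; have [_ gi] := hg j; have [_] := hg j'.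
  by rewrite -gj gi => -[].
by have [fj gi] := hg j; move: fj; rewrite hN// gi.
Qed.

End FiniteColumnsHard.

(** * Reducing finiteness of columns to the ideal *)

Section FiniteColumnsReduction.
Variables (J : set (set nat)) (e : nat -> nat -> bool).
Hypothesis idealJ : ideal J.
Hypothesis properJ : ~ J [set: nat].
Hypothesis tallJ : tall J.
Hypothesis sepJ : separating J e.

(** Each digit 1 in column [i] adds a finite block of indices close to the positive set [K i] near
    [x]. If all columns are finite, the union converges to [x] alone; an infinite column
    approximates every point of [K i], which separation forbids for members of [J]. *)
Lemma finite_columns_reduction : exists psi : (nat -> bool) -> nat -> bool,
  (forall x y d, agree d.+1 x y -> psi x d = psi y d) /\
  forall z, finite_columns z <-> J [set d | psi z d].
Proof.
have [x xF] := positive_part_nonempty e idealJ properJ.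
pose K i := positive_part J e setT `&` [set y | agree i y x].
have /choice[N hN] := fun c => window_bound e c c.
pose G c := [set d | (c <= d) && (d < N c) /\
  exists2 y, K (position c).1 y & agree c (e d) y].
exists (fun z d => `[< exists c, z c /\ G c d >]); split=> [y z d yz|z].
  apply: asbool_equiv_eq; split=> -[c [zc Gcd]]; exists c; split=> //.
    by rewrite -yz//; case: Gcd => /andP[].
  by rewrite yz//; case: Gcd => /andP[].
split=> [fin|Jz i]; last first.
  apply: contrapT => /forallNP inf.
  have [n [zn /(positive_part_nonempty e idealJ)[y yn]]] := sepJ Jz (xF i).
  have Ky : K i y.
    by apply: (positive_part_cell idealJ); apply: positive_part_sub yn => // k [].
  have [d [[_ dn] _ dy]] := positive_part_unbounded idealJ n.+1 0 yn.
  have /existsNP[c /not_implyP[nc /not_implyP[ci zc]]] := inf n.+1.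
  have yinf : infinite_cell e c y.
    move=> M; have [d' [_ Md' d'y]] := positive_part_unbounded idealJ c M Ky.1.
    by exists d'.
  have [d' d'c d'y] := hN c y yinf.
  have : `[< exists c, z c /\ G c d' >].
    apply/asboolP; exists c; split; first by case: (z c) zc.
    by split=> //; exists y => //; rewrite ci.
  move=> /zn; rewrite d'y// -(dy n)//.
  by move: dn => /= ->.
apply: (small1 idealJ tallJ sepJ (x := x)) => n.
have [M hM] : exists M, forall c, M <= c -> (position c).1 < n -> z c = false.
  elim: n => [|n [M hM]]; first by exists 0.
  have [M' hM'] := fin n; exists (maxn M M') => c Mc.
  rewrite ltnS leq_eqVlt => /orP[/eqP/hM'|/hM]; apply; lia.
exists (\max_(c < maxn M n) N c) => d /asboolP[c [zc [/andP[cd dN] [y [_ yi] dy]]]].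
move=> Nd; exists x => //; have Mc : maxn M n <= c.
  rewrite leqNgt; apply/negP => cM.
  have := leq_trans dN (leq_trans (@leq_bigmax _ (fun i : 'I_(maxn M n) => N i)
    (Ordinal cM)) Nd).
  by rewrite ltnn.
have ni : n <= (position c).1.
  by rewrite leqNgt; apply/negP => /hM; rewrite zc => /(_ _)/negP; apply; lia.
by apply: agree_trans (agree_le _ dy) (agree_le ni yi); lia.
Qed.

End FiniteColumnsReduction.

(** * Reductions from zero-dimensional Polish spaces *)

Section Hardness.
Context {R : realType}.

Lemma zero_dimensional_code (Y : metricType R) : separable Y -> clopen_basis Y ->
  exists h : Y -> nat -> bool, (forall i, clopen [set y | h y i]) /\
  forall y A, nbhs y A -> exists n, forall y', agree n (h y) (h y') -> A y'.
Proof.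
move=> /separable_countable_base[U [Uo Ub]] [B Bcl [Bo Bb]].
have [p|C hC] := @choice _ _ (fun (p : nat * nat) (C : set Y) => clopen C /\
    forall V, clopen V -> U p.1 `<=` V -> V `<=` U p.2 ->
    U p.1 `<=` C /\ C `<=` U p.2).
  have [[V [Vcl V1 V2]]|nV] := pselect (exists V, [/\ clopen V,
      U p.1 `<=` V & V `<=` U p.2]); first by exists V.
  exists set0; split; first by split; [exact: open0|exact: closed0].
  by move=> V Vcl V1 V2; case: nV; exists V.
exists (fun y m => if (unpickle m : option (nat * nat)) is Some p
  then `[< C p y >] else false); split=> [i|y A yA].
  case: (unpickle i) => [p|].
    suff -> : [set y | `[< C p y >]] = C p by case: (hC p).
    by apply/seteqP; split=> y /= /asboolP.
  suff -> : [set y : Y | false] = set0 by split; [exact: open0|exact: closed0].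
  by apply/seteqP; split.
have [l [Uly UlA]] := Ub _ _ yA.
have [V [BV Vy] VU] := Bb y (U l) (open_nbhs_nbhs (conj (Uo l) Uly)).
have [k [Uky UkV]] := Ub _ _ (open_nbhs_nbhs (conj (Bo V BV) Vy)).
have [_ /(_ V (Bcl V BV) UkV VU)[UC CU]] := hC (k, l).
exists (pickle (k, l)).+1 => y' /(_ _ (leqnn _)); rewrite pickleK.
rewrite asboolT; last exact: UC.
by move=> /esym/asboolP/CU/UlA.
Qed.

Lemma code_nbhs (Y : topologicalType) (h : Y -> nat -> bool) n (y : Y) :
  (forall i, clopen [set y | h y i]) -> nbhs y [set y' | agree n (h y) (h y')].
Proof.
move=> hcl; elim: n => [|n ih].
  by apply: filterS filterT.
have : nbhs y [set y' | h y n = h y' n].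
  have [ho hc] := hcl n; case: (boolP (h y n)) => yn.
    apply: filterS (open_nbhs_nbhs (conj ho yn)) => y' /= ->//.
  have := open_nbhs_nbhs (conj (closed_openC hc) (negP yn)).
  by apply: filterS => y' /negP y'n /=; rewrite (negbTE y'n).
move=> /(filterI ih); apply: filterS => y' [/= yy' yn] i.
by rewrite ltnS leq_eqVlt => /orP[/eqP->|/yy'].
Qed.

Lemma code_continuous (Y : topologicalType) (h : Y -> nat -> bool)
    (phi : Y -> cantor_space) :
  (forall i, clopen [set y | h y i]) ->
  (forall d, exists m, forall y y', agree m (h y) (h y') -> phi y d = phi y' d) ->
  continuous phi.
Proof.
move=> hcl /choice[m hm] y A /cantor_nbhsP[n nA].
apply: (@filterS _ _ _ [set y' | agree (\max_(d < n) m d) (h y) (h y')]).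
  move=> y' yy'; apply: nA => d dn; apply: hm; apply: agree_le yy'.
  exact: (@leq_bigmax _ (fun d : 'I_n => m d) (Ordinal dn)).
exact: code_nbhs.
Qed.

Lemma code_closed (Y : topologicalType) (h : Y -> nat -> bool) (C : set Y) y :
  (forall y A, nbhs y A -> exists n, forall y', agree n (h y) (h y') -> A y') ->
  closed C -> ~ C y -> exists n, forall y', agree n (h y) (h y') -> ~ C y'.
Proof.
move=> hn Ccl nC; apply: (hn y (~` C)).
by apply: open_nbhs_nbhs; split=> //; apply: closed_openC.
Qed.

Lemma Pi03P (T : topologicalType) (B : set T) : Pi03 B ->
  exists C : nat -> nat -> set T, (forall i j, closed (C i j)) /\
  forall y, B y <-> forall i, exists j, C i j y.
Proof.
case=> F /[swap] -> /(_ _)-FF.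
have /choice[C hC] : forall i, exists C : nat -> set T,
    (forall j, closed (C j)) /\ F i = \bigcup_j C j.
  by move=> i; have [C Ccl FE] := FF i; exists C.
exists C; split=> [i j|y]; first by case: (hC i).
split=> [h i|h i _].
  by have := h i I; case: (hC i) => _ -> [j _]; exists j.
by case: (hC i) => _ ->; have [j] := h i; exists j.
Qed.

Lemma Pi03_hard (J : set (set nat)) (e : nat -> nat -> bool) :
  ideal J -> ~ J [set: nat] ->
  tall J -> separating J e ->
  hard R Pi03 (char_set J).
Proof.
move=> idealJ properJ tallJ sepJ Y [sepY _] Ycb B /Pi03P[C [Ccl BE]].
have [h [hcl hn]] := zero_dimensional_code sepY Ycb.
have [psi [psiE psiP]] := finite_columns_reduction idealJ properJ tallJ sepJ.
have [|phi [phiE phiP]] := @finite_columns_hard Y h C.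
  by move=> i j y; apply: code_closed.
exists (fun y => psi (phi y) : cantor_space).
  apply: code_continuous hcl _ => d; exists d => y y' yy'.
  by apply: psiE => i id; apply: phiE; apply: agree_le yy'.
by apply/seteqP; split=> y /=; rewrite BE phiP psiP.
Qed.

(* The tree of attempts at finding [beta] with [g beta = y]: a node of length
   [n] is kept while some extension has an image sharing [n] digits with [y]. *)
Lemma coanalytic_hard_of_trees (J : set (set nat)) (G : seq nat -> set nat) :
  J set0 -> (forall s d, G s d -> pickle s <= d) ->
  (forall T : set (seq nat), (forall s t, T (s ++ t) -> T s) ->
    J (\bigcup_(s in T) G s) <-> ~ exists x, forall n, T (mkseq x n)) ->
  hard R coanalytic (char_set J).
Proof.
move=> J0 Gp GJ Y [sepY _] Ycb B [B0|[g gc gE]].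
  (* Here [B] is the whole space, reduced by the constant map to the empty set of indices. *)
  exists (fun=> (fun=> false) : cantor_space).
    by move=> y; apply: cst_continuous.
  have E : [set n : nat | false] = set0 by apply/seteqP; split.
  apply/seteqP; split=> y _; first by rewrite /char_set /preimage /= E.
  by apply: contrapT => nB; have : (~` B) y by []; rewrite B0.
have [h [hcl hn]] := zero_dimensional_code sepY Ycb.
pose T y := [set s | exists2 x : baire_space,
  mkseq x (size s) = s & agree (size s) (h y) (h (g x))].
have TE y y' s : agree (size s) (h y) (h y') -> T y s -> T y' s.
  by move=> yy' [x xs yx]; exists x => //; apply: agree_trans yx; apply: agree_sym.
have Tpre y s t : T y (s ++ t) -> T y s.
  move=> [x xst yx]; exists x; last by apply: agree_le yx; rewrite size_cat leq_addr.
  have E : take (size s) (mkseq x (size (s ++ t))) = s.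
    by rewrite xst take_size_cat.
  by rewrite -[RHS]E size_cat /mkseq -map_take take_iota (minn_idPl (leq_addr _ _)).
have hg x n : exists m, forall x' : baire_space, agree m x x' ->
    agree n (h (g x)) (h (g x')).
  have := gc x _ (code_nbhs n (g x) hcl); move=> /baire_nbhsP[m hm].
  by exists m => x' /hm.
have TB y : (exists x, forall n, T y (mkseq x n)) <-> (~` B) y.
  rewrite gE; split=> [[x hx]|[x _ <-]]; last first.
    by exists x => n; exists x; rewrite size_mkseq.
  exists (x : baire_space) => //; apply: (@metric_hausdorff _ Y) => A A' xA yA'.
  have [n hnA] := hn _ _ yA'; exists (g x); split; first exact: nbhs_singleton.
  apply: hnA; have [m hm] := hg x n.
  have [x'] := hx (maxn n m); rewrite size_mkseq => /agree_mkseq x'x yx'.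
  apply: agree_trans (agree_le _ yx') (agree_sym (hm _ _)).
    by rewrite leq_maxl.
  by apply: agree_le (agree_sym x'x); rewrite leq_maxr.
exists (fun y => (fun d => `[< (\bigcup_(s in T y) G s) d >]) : cantor_space).
  apply: code_continuous hcl _ => d.
  pose len c := if (unpickle c : option (seq nat)) is Some s then size s else 0.
  (* Only [s] with [pickle s <= d] can contribute [d], and whether [s] is in [T y] depends on
     [size s] digits of [h y]. *)
  exists (\max_(c < d.+1) len c) => y y' yy'.
  have sd s : G s d -> size s <= \max_(c < d.+1) len c.
    move=> /Gp sd; have := @leq_bigmax _ (fun c : 'I_d.+1 => len c)
      (Ordinal (sd : pickle s < d.+1)).
    by rewrite /len pickleK.
  apply: asbool_equiv_eq; split=> -[s Ts Gs]; exists s => //.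
    by apply: TE Ts; apply: agree_le yy'; apply: sd.
  by apply: TE Ts; apply: agree_le (agree_sym yy'); apply: sd.
apply/seteqP; split=> y; rewrite /char_set /=.
  move=> By; have -> : [set n | `[< (\bigcup_(s in T y) G s) n >]] =
      \bigcup_(s in T y) G s by apply/seteqP; split=> d /= /asboolP.
  by apply/GJ; [exact: Tpre|move=> /TB].
have -> : [set n | `[< (\bigcup_(s in T y) G s) n >]] =
      \bigcup_(s in T y) G s by apply/seteqP; split=> d /= /asboolP.
move=> /(GJ _ (@Tpre y)) nb; apply: contrapT => nB; apply: nb.
exact/TB.
Qed.

(** The even places of [w] hold a matrix and the odd places a bound for each column. Cutting the
    columns at their bounds maps the Baire space continuously onto the matrices with finite
    columns. *)
Lemma analytic_finite_columns (e : nat -> nat -> bool)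
    (e_dense : forall x n, exists k, agree n (e k) x) :
  coanalytic [set y : closed_range R e | ~ finite_columns (sval y)].
Proof.
right; pose z (w : baire_space) c :=
  odd (w c.*2) && (c < w (position c).1.*2.+1).
have zin w : forall n, exists k, agree n (e k) (z w) by move=> n; apply: e_dense.
exists (fun w => exist _ (z w) (zin w)).
  move=> w A /closed_range_nbhsP[n nA]; apply/baire_nbhsP.
  exists (\max_(c < n) (maxn c.*2 (position c).1.*2.+1).+1) => w' ww'.
  apply: nA => c cn /=.
  have cmax := @leq_bigmax _ (fun c : 'I_n => (maxn c.*2 (position c).1.*2.+1).+1)
    (Ordinal cn).
  rewrite /= in cmax.
  by rewrite /z !ww'//; apply: leq_trans cmax; rewrite ltnS ?leq_maxl ?leq_maxr.
apply/seteqP; split=> [y /= /contrapT/choice[N hN]|_ [w _ <-] /=]; last first.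
  move=> nf; apply: nf => i; exists (w i.*2.+1) => c wc ci.
  by rewrite /z ci ltnNge wc andbF.
pose w : baire_space := fun n => if odd n then N n./2 else sval y n./2.
exists w => //; apply: closed_range_inj; apply/funext => c /=.
rewrite /z /w /= odd_double /= uphalf_double doubleK odd_double /= oddb.
case: (ltnP c (N (position c).1)) => [_|Nc]; first by rewrite andbT.
by rewrite andbF (hN _ _ Nc).
Qed.

(** Hardness reduces the matrices with an infinite column to [A], so they would form a Pi^0_3 set,
    which in turn reduces to finiteness of columns. A fixed point of the latter reduction has finite
    columns exactly when it has an infinite one. *)
Lemma not_Pi03_coanalytic_hard (A : set cantor_space) :
  Pi03 A -> ~ hard R coanalytic A.
Proof.
move=> /Pi03P[C [Ccl AE]] hardA.
pose e k i := if (unpickle k : option (seq bool)) is Some s then nth false s i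
  else false.
have e_dense x n : exists k, agree n (e k) x.
  by exists (pickle (mkseq x n)) => i ni; rewrite /e pickleK nth_mkseq.
have [g gc gE] := hardA _ (@closed_range_polish R e)
  (@closed_range_clopen_basis R e) _ (analytic_finite_columns e_dense).
pose pt x : closed_range R e := exist _ x (e_dense x).
have [i j y nC|phi [phiE phiP]] :=
    @finite_columns_hard _ (fun y : closed_range R e => sval y)
      (fun i j => g @^-1` C i j).
  have /closed_range_nbhsP[n nA] : nbhs y (g @^-1` ~` C i j).
    apply: gc; apply: open_nbhs_nbhs; split=> //; exact: closed_openC.
  by exists n.
have [x xE] : exists x, phi (pt x) = x.
  by apply: (@fixed_point (fun x => phi (pt x))) => x y n xy; apply: phiE.
have h1 : ~ finite_columns x <-> A (g (pt x)).
  by rewrite -[A _]/((g @^-1` A) (pt x)) -gE.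
have h2 := phiP (pt x); rewrite xE in h2.
have h3 := AE (g (pt x)).
have nf : ~ finite_columns x by move=> /[dup] fx /h2/h3/h1; apply.
by apply/nf/h2/h3/h1.
Qed.

End Hardness.

(** * Complexity of ideals with compact representations *)

Lemma closure_bigcup_seq (X : topologicalType) (U : nat -> set X) (V : set X)
    (l : seq nat) : (forall n, n \in l -> closure (U n) `<=` V) ->
  closure (\bigcup_(n in [set` l]) U n) `<=` V.
Proof.
move=> h.
suff E (s : seq nat) : {subset s <= l} -> closure (\bigcup_(n in [set` s]) U n) `<=` V.
  exact: E.
elim: s => [|n s ih] sl; first by rewrite set_nil bigcup_set0 closure0.
have -> : [set` n :: s] = [set n] `|` [set` s].
  by apply/seteqP; split=> i /=; rewrite inE => /predU1P.
rewrite bigcup_setU bigcup_set1 closureU => x [|]; last first.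
  by apply: ih => i si; apply: sl; rewrite inE si orbT.
by apply: h; apply: sl; rewrite inE eqxx.
Qed.

(* The library's [compact_cover] is restricted to pointed spaces. *)
Lemma compact_countable_subcover (X : topologicalType) (A : set X)
    (D : set nat) (U : nat -> set X) :
  compact A -> (forall n, open (U n)) -> A `<=` \bigcup_(n in D) U n ->
  exists2 l : seq nat, (forall n, n \in l -> D n) &
    A `<=` \bigcup_(n in [set` l]) U n.
Proof.
move=> cA Uo AU.
pose V N := \bigcup_(n in D `&` `I_N) U n.
pose F : set_system X := filter_from setT (fun N => A `\` V N).
have [[N AV]|ncov] := pselect (exists N, A `<=` V N).
  exists [seq n <- iota 0 N | `[< D n >]].
    by move=> n; rewrite mem_filter => /andP[/asboolP].
  move=> x /AV[n [Dn nN] Unx]; exists n => //=.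
  by rewrite mem_filter mem_iota asboolT.
have FF : ProperFilter F.
  apply: filter_from_proper; last first.
    move=> N _; apply: contrapT => /nonemptyPn AV0; apply: ncov; exists N => x Ax.
    by apply: contrapT => nV; have : (A `\` V N) x by []; rewrite AV0.
  apply: filter_from_filter; first by exists 0.
  move=> i j _ _; exists (maxn i j) => // x [Ax nV].
  by split; split=> // -[n [Dn /= ni] Un]; apply: nV; exists n => //;
    split=> //=; rewrite leq_max ni ?orbT.
have [|x [Ax xF]] := cA F FF; first by exists 0 => // x [].
have [n Dn Unx] := AU x Ax.
have [||y [[_ nV] Uny]] := xF (A `\` V n.+1) (U n).
- by exists n.+1.
- exact: open_nbhs_nbhs.
- by exfalso; apply: nV; exists n => //; split=> //=.
Qed.

Section CompactRepresentationComplexity.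
Context {R : realType} {X : metricType R}.
Hypothesis compactX : compact [set: X].
Hypothesis sepX : separable X.
Variable rho : nat -> X.

Lemma compact_closure (A : set X) : compact (closure A).
Proof.
by apply: (@subclosed_compact _ _ [set: X]) => //; exact: closed_closure.
Qed.

Definition closure_hyper (a : set nat) : hyperspace X :=
  exist _ _ (@compact_closure (rho @` a)).

(** Membership in [O] is witnessed by a finite subset [s] of the indices and a finite union of basic
    open sets containing the image. There are countably many such pairs, and each defines a closed
    condition on [x]. *)
Lemma vietoris_open_Fsigma (O : set (hyperspace X)) : open O ->
  Fsigma [set x : cantor_space | O (closure_hyper [set k | x k])].
Proof.
move=> Oo; have [U [Uo Ub]] := separable_countable_base sepX.
pose B (l : seq nat) := \bigcup_(n in [set` l]) U n.
pose valid (s l : seq nat) := forall L : hyperspace X,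
  rho @` [set` s] `<=` sval L -> sval L `<=` closure (B l) -> O L.
pose S (s l : seq nat) := [set x : cantor_space |
  (forall k, k \in s -> x k) /\ forall k, x k -> B l (rho k)].
have Scl s l : closed (S s l).
  move=> x xS.
  have near k : exists2 y : cantor_space, S s l y & x k = y k.
    have [|y [Sy xy]] := xS [set y : cantor_space | agree k.+1 x y].
      by apply/cantor_nbhsP; exists k.+1.
    by exists y => //; apply: xy.
  split=> k; have [y [y1 y2] ->] := near k; [exact: y1|exact: y2].
exists (fun c => if (unpickle c : option (seq nat * seq nat)) is Some p
  then (if `[< valid p.1 p.2 >] then S p.1 p.2 else set0) else set0).
  move=> c; case: unpickle => [p|]; last exact: closed0.
  by case: asboolP => // _; exact: closed0.
apply/seteqP; split=> x /=; last first.
  move=> [c _]; case: unpickle => [[s l]|//] /=; case: asboolP => // v [sx xB].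
  apply: v => /=.
    by move=> _ [k ks <-]; apply: subset_closure; exists k => //; apply: sx.
  by apply: closureS => _ [k xk <-]; apply: xB.
move=> Ox; have [sb [sb_sub sbx sbO]] := vietoris_openP Oo Ox.
have [s [V [sx Vo xV sV]]] : exists (s : seq nat) (V : set X),
    [/\ forall k, k \in s -> x k, open V,
        closure (rho @` [set k | x k]) `<=` V
      & forall L : hyperspace X, rho @` [set` s] `<=` sval L -> sval L `<=` V ->
        forall A, A \in sb -> A L].
  elim: sb {sbO} sb_sub sbx => [|A sb ih] sb_sub sbx.
    by exists [::], setT; split=> //; exact: openT.
  have [||s [V [sx Vo xV sV]]] := ih.
  - by move=> C Csb; apply: sb_sub; rewrite inE Csb orbT.
  - by move=> C Csb; apply: sbx; rewrite inE Csb orbT.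
  have [W Wo AE] := sb_sub A (mem_head _ _).
  have := sbx A (mem_head _ _); case: AE => -> /=.
    move=> xW; exists s, (V `&` W); split=> //.
    + exact: openI.
    + by move=> y cy; split; [apply: xV|apply: xW].
    + move=> L sL LV C; rewrite inE => /orP[/eqP->|Csb].
        by move=> y /LV[].
      by apply: sV Csb => // y /LV[].
  move=> [y [cy Wy]].
  have [_ [[k xk <-] Wk]] := cy _ (open_nbhs_nbhs (conj Wo Wy)).
  exists (k :: s), V; split=> //.
  - by move=> j; rewrite inE => /orP[/eqP->|/sx].
  - move=> L sL LV C; rewrite inE => /orP[/eqP->|Csb].
      by exists (rho k); split=> //; apply: sL; exists k => //=; rewrite mem_head.
    apply: sV Csb => // _ [j js <-]; apply: sL; exists j => //=.
    by rewrite inE; apply/orP; right.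
(* Compactness replaces [V] by a finite union of basic sets whose closures lie in [V]. *)
have [||l lV cl] := @compact_countable_subcover _ (closure (rho @` [set k | x k]))
    [set n | closure (U n) `<=` V] U _ Uo.
- exact: compact_closure.
- move=> y /xV Vy.
  have [C yC CV] := uniform_regular (open_nbhs_nbhs (conj Vo Vy)).
  have [n [Uy UC]] := Ub _ _ yC; exists n => //=.
  exact: subset_trans (closureS UC) CV.
exists (pickle (s, l)) => //; rewrite pickleK /= asboolT.
  by split=> // k xk; apply: cl; apply: subset_closure; exists k.
move=> L sL Ll; apply: sbO; apply: sV => //.
by apply: subset_trans Ll _; apply: closure_bigcup_seq.
Qed.

End CompactRepresentationComplexity.

(** An intersection of countably many Vietoris open sets pulls back to an intersection of [Fsigma]
    sets. *)
Lemma represented_Pi03 (R : realType) (J : set (set nat)) :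
  represented_by_Pi02_compact R J -> Pi03 (char_set J).
Proof.
move=> [X [I [D [rho [cX [_ [W Wo IE]] Dc Dd [_ JE]]]]]].
have sepX : separable X by exists D.
exists (fun n => [set x : cantor_space |
  W n (closure_hyper cX rho [set k | x k])]).
  by move=> n; apply: vietoris_open_Fsigma.
have memJ a : J a <-> I (closure_hyper cX rho a).
  rewrite JE /=; split=> [[K IK Ka]|h]; last by eexists; first exact: h.
  suff -> : closure_hyper cX rho a = K by [].
  case: K Ka {IK} => K cK /= Ka; rewrite /closure_hyper; subst K.
  by congr exist; apply: Prop_irrelevance.
apply/seteqP; split=> x; rewrite /char_set /=.
  by move=> /memJ; rewrite IE => h n _; apply: h.
by move=> h; apply/memJ; rewrite IE => n _; apply: h.
Qed.

Lemma represented_or_hard (R : realType) (J : set (set nat))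
    (e : nat -> nat -> bool) :
  ideal J -> ~ J [set: nat] -> coanalytic (char_set J) -> injective e ->
  tall J -> separating J e ->
  represented_by_Pi02_compact R J \/ hard R coanalytic (char_set J).
Proof.
move=> idealJ properJ [J0|[f fc fE]] e_inj tallJ sepJ.
  have : (~` char_set J) (fun=> true).
    rewrite /char_set /setC /= => h; apply: properJ.
    by apply: (J_sub idealJ) h.
  by rewrite J0.
pose g (x : nat -> nat) : nat -> bool := f x.
have g_continuous x n : exists m, forall y, agree m x y -> agree n (g x) (g y).
  have /baire_nbhsP[m hm] : nbhs (x : baire_space)
      (f @^-1` [set y : cantor_space | agree n (f x) y]).
    by apply: fc; apply/cantor_nbhsP; exists n.
  by exists m.
have g_range b : ~ J b <-> exists x, b = [set d | g x d].
  split=> [nJ|[x ->]]; last first.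
    have : (~` char_set J) (f x) by rewrite fE; exists x.
    exact.
  have : (~` char_set J) (fun d => `[< b d >]).
    rewrite /char_set /setC /=.
    by have -> : [set n | `[< b n >]] = b by apply/seteqP; split=> d /= /asboolP.
  rewrite fE => -[x _ fx]; exists x; apply/seteqP.
  by rewrite /g fx; split=> d /= /asboolP.
(* The Hurewicz dichotomy: an empty kernel means that countably many closed families exhaust the
   non-small compact sets; a kernel point starts the scheme. *)
have [ker|/eqP/set0P ker] := pselect (kernel J e g = set0).
  left; apply: (small_compact_represents R idealJ e_inj tallJ sepJ).
  exact: kernel0_cover ker.
right; have [G [Gp GJ]] := hurewicz_scheme idealJ tallJ sepJ g_continuous g_range ker.
by apply: coanalytic_hard_of_trees Gp GJ; apply: (@J_bounded _ idealJ _ 0).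
Qed.

Theorem corollary1p5 (R : realType) (J : set (set nat))
  (idealJ : ideal J)
  (properJ : ~ J [set: nat])
  (coanalyticJ : coanalytic (char_set J))
  (representedJ : topologically_represented R J) :
  (complete_for R Pi03 (char_set J) \/
   complete_for R coanalytic (char_set J)) /\
  (complete_for R Pi03 (char_set J) <-> represented_by_Pi02_compact R J).
Proof.
have [X [I [D [rho [sepX idealI _ _ [rho_bij JE]]]]]] := representedJ.
have [e [e_inj tallJ sepJ]] := represented_code sepX idealI rho_bij JE.
have h3 := Pi03_hard (R := R) idealJ properJ tallJ sepJ.
have rep3 : represented_by_Pi02_compact R J -> complete_for R Pi03 (char_set J).
  by move=> /represented_Pi03.
have [rep|h1] := represented_or_hard R idealJ properJ coanalyticJ e_inj tallJ sepJ.
  by split; [left; exact: rep3|split].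
split; first by right.
(* A Pi^1_1-hard [J] is not Pi^0_3, so in this case both sides of the equivalence fail. *)
by split=> // -[/not_Pi03_coanalytic_hard nh _]; case: (nh R h1).
Qed.
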